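(* There are absolute constants $A_1,A_2>1$ such that the following holds. Let $U\colon C(K)\to X$ be a linear operator of norm $1$, where $K$ is a compact Hausdorff space and $X$ is a Banach space. Suppose that for some subspace $E\subseteq C(K)$ such that $d(E,l_2^n)=a$, $n\ge 2$, one has $\|Ux\|\ge b\|x\|$ for all $x\in E$, where $b>0$. Then there is a subspace $G\subseteq C(K)$ and an integer $j\ge A_2^{(b/a)^4 n}$ such that $d(G,l_\infty^j)<2$ and $\|Ux\|\ge A_1^{-(a/b)^2}\|x\|$ for all $x\in G$.
   Context: $d(\cdot,\cdot)$ denotes the Banach–Mazur distance between Banach spaces of equal dimension. *)

(* Defs.v *)
From HB Require Import structures.
From mathcomp Require Import all_boot all_order all_algebra.
From mathcomp Require Import all_classical all_reals all_analysis.
From mathcomp Require Import ring.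

Set Implicit Arguments.
Unset Strict Implicit.
Unset Printing Implicit Defensive.

Import Order.TTheory GRing.Theory Num.Theory.
Import numFieldNormedType.Exports.

Local Open Scope classical_set_scope.
Local Open Scope ring_scope.

Section contfun_pred.
Context (R : realType) (K : topologicalType).

Definition contfun_pred : {pred K -> R} := mem [set f : K -> R | continuous f].

Fact contfun_submod_closed : submod_closed contfun_pred.
Proof.
split=> [|a f g]; first by rewrite inE /= => x; exact: cvg_cst.
rewrite !inE /= => cf cg x.
by apply: cvgD; [apply: cvgZr; exact: cf|exact: cg].
Qed.

HB.instance Definition _ :=
  GRing.isSubmodClosed.Build R (K -> R) contfun_pred contfun_submod_closed.

End contfun_pred.

(* C(K), with real scalars. The compactness proof is a parameter of the type
   because it is what makes the supremum norm finite. *)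
Record contfun (R : realType) (K : topologicalType) (cptK : compact [set: K]) :=
  ContFun {
    contfun_val :> K -> R ;
    contfunP : contfun_val \in @contfun_pred R K }.
Arguments contfun R {K} cptK.

Section contfun_normed.
Context (R : realType) (K : topologicalType) (cptK : compact [set: K]).
Local Notation C := (contfun R cptK).

HB.instance Definition _ := [isSub for @contfun_val R K cptK].
HB.instance Definition _ := [Choice of C by <:].
HB.instance Definition _ := [SubChoice_isSubLmodule of C by <:].

(* sup set0 = 0, so this is also the right value when K is empty. *)
Definition supnorm (f : C) : R := sup [set `|f x| | x in [set: K]].

Let supnorm_ub (f : C) x : `|f x| <= supnorm f.
Proof.
have [M [_ /(_ (M + 1))]] : bounded_set (contfun_val f @` [set: K]).
  apply/compact_bounded/continuous_compact => //.
  by apply: continuous_subspaceT; move: (contfunP f); rewrite inE.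
rewrite ltrDl ltr01 => /(_ isT) Mf.
apply: ub_le_sup; last by exists x.
by exists (M + 1) => _ [y _ <-]; apply: Mf; exists y.
Qed.

Let supnorm_le (f : C) (M : R) :
  0 <= M -> (forall x, `|f x| <= M) -> supnorm f <= M.
Proof.
move=> M0 fM; have [[k _]|/set0P/negP/negPn/eqP K0] := pselect ([set: K] !=set0).
  by apply: ge_sup => [|_ [x _ <-]//]; exists `|f k|, k.
by rewrite /supnorm K0 image_set0 sup0.
Qed.

Let supnorm_ge0 (f : C) : 0 <= supnorm f.
Proof.
have [[x _]|/set0P/negP/negPn/eqP K0] := pselect ([set: K] !=set0).
  by rewrite (le_trans _ (supnorm_ub f x)).
by rewrite /supnorm K0 image_set0 sup0.
Qed.

Let ler_supnormD (f g : C) : supnorm (f + g) <= supnorm f + supnorm g.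
Proof.
apply: supnorm_le => [|x]; first by rewrite addr_ge0 ?supnorm_ge0.
by rewrite (le_trans (ler_normD _ _))// lerD ?supnorm_ub.
Qed.

Let supnormZ (l : R) (f : C) : supnorm (l *: f) = `|l| * supnorm f.
Proof.
have leZ (k : R) (g : C) : supnorm (k *: g) <= `|k| * supnorm g.
  apply: supnorm_le => [|x]; first by rewrite mulr_ge0 ?supnorm_ge0.
  by rewrite normrM ler_wpM2l ?supnorm_ub.
apply/eqP; rewrite eq_le leZ /=.
have [->|l0] := eqVneq l 0; first by rewrite normr0 mul0r.
rewrite -ler_pdivlMl ?normr_gt0// -normfV.
by have := leZ l^-1 (l *: f); rewrite scalerA mulVf// scale1r.
Qed.

Let supnorm0_eq0 (f : C) : supnorm f = 0 -> f = 0.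
Proof.
move=> f0; apply/val_inj/funext => x /=.
by apply/eqP; rewrite -normr_le0 -f0.
Qed.

HB.instance Definition _ :=
  @Lmodule_isNormed.Build R C supnorm ler_supnormD supnormZ supnorm0_eq0.

End contfun_normed.

(* A linear subspace E of V as a space in its own right, with the norm of V. *)
Record subsp (R : realType) (V : normedModType R) (E : submodClosed V) :=
  Subsp {
    subsp_val :> V ;
    subspP : subsp_val \in E }.

Section subsp_normed.
Context (R : realType) (V : normedModType R) (E : submodClosed V).
Local Notation S := (subsp E).

HB.instance Definition _ := [isSub for @subsp_val R V E].
HB.instance Definition _ := [Choice of S by <:].
HB.instance Definition _ := [SubChoice_isSubLmodule of S by <:].

Let nm (x : S) : R := `|val x|.

Let ler_nmD (x y : S) : nm (x + y) <= nm x + nm y.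
Proof. exact: ler_normD. Qed.

Let nmZ (l : R) (x : S) : nm (l *: x) = `|l| * nm x.
Proof. exact: normrZ. Qed.

Let nm0_eq0 (x : S) : nm x = 0 -> x = 0.
Proof. by move=> /normr0_eq0 x0; apply: val_inj. Qed.

HB.instance Definition _ :=
  @Lmodule_isNormed.Build R S nm ler_nmD nmZ nm0_eq0.

End subsp_normed.

(* The norm that the library puts on 'rV[R]_n is the maximum norm, so
   l_infty^n is 'rV[R]_n itself; l_2^n is an alias with the Euclidean norm. *)
Definition linfty (R : realType) (n : nat) : normedModType R := 'rV[R]_n.

Definition l2 (R : realType) (n : nat) : Type := 'rV[R]_n.

Section l2_normed.
Context (R : realType) (n : nat).
Local Notation L := (l2 R n).

HB.instance Definition _ := GRing.Lmodule.copy L 'rV[R]_n.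

Definition l2norm (x : 'rV[R]_n) : R := Num.sqrt (\sum_(i < n) x 0 i ^+ 2).

Let sumsq_ge0 (x : 'rV[R]_n) : 0 <= \sum_(i < n) x 0 i ^+ 2.
Proof. by apply: sumr_ge0 => i _; exact: sqr_ge0. Qed.

Let l2norm_sqr (x : 'rV[R]_n) : l2norm x ^+ 2 = \sum_(i < n) x 0 i ^+ 2.
Proof. by rewrite sqr_sqrtr. Qed.

Let l2norm0_eq0 (x : L) : l2norm x = 0 -> x = 0.
Proof.
move=> x0; have := l2norm_sqr x; rewrite x0 expr0n /= => /esym/eqP.
rewrite psumr_eq0 => [/allP z|i _]; last exact: sqr_ge0.
apply/rowP => i; rewrite mxE; apply/eqP.
by have := z i; rewrite mem_index_enum sqrf_eq0 => /(_ isT).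
Qed.

Let cauchy_schwarz (x y : 'rV[R]_n) :
  \sum_(i < n) x 0 i * y 0 i <= l2norm x * l2norm y.
Proof.
have [x0|x0] := eqVneq (l2norm x) 0.
  rewrite x0 mul0r big1// => i _.
  by rewrite (l2norm0_eq0 x0) mxE mul0r.
have [y0|y0] := eqVneq (l2norm y) 0.
  rewrite y0 mulr0 big1// => i _.
  by rewrite (l2norm0_eq0 y0) mxE mulr0.
have p : 0 < l2norm x * l2norm y.
  by rewrite mulr_gt0// lt_neqAle eq_sym ?x0 ?y0 sqrtr_ge0.
rewrite -(ler_pM2l p) -subr_ge0 -(pmulr_rge0 _ (ltr0Sn R 1)).
set a := l2norm x; set b := l2norm y.
have : 0 <= \sum_(i < n) (b * x 0 i - a * y 0 i) ^+ 2.
  by apply: sumr_ge0 => i _; exact: sqr_ge0.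
suff -> : \sum_(i < n) (b * x 0 i - a * y 0 i) ^+ 2 =
  2 * (a * b * (a * b) - a * b * \sum_(i < n) x 0 i * y 0 i) by [].
transitivity (\sum_(i < n) (b ^+ 2 * x 0 i ^+ 2 + a ^+ 2 * y 0 i ^+ 2
    - 2 * (a * b) * (x 0 i * y 0 i))).
  by apply: eq_bigr => i _; ring.
rewrite sumrB big_split /= -!mulr_sumr -!l2norm_sqr -/a -/b; ring.
Qed.

Let ler_l2normD (x y : L) : l2norm (x + y) <= l2norm x + l2norm y.
Proof.
rewrite -ler_sqr ?nnegrE ?addr_ge0 ?sqrtr_ge0// l2norm_sqr.
rewrite (_ : \sum_(i < n) _ = \sum_(i < n) (x 0 i ^+ 2 + y 0 i ^+ 2
    + 2 * (x 0 i * y 0 i))); last by apply: eq_bigr => i _; rewrite mxE; ring.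
rewrite !big_split /= -mulr_sumr -!l2norm_sqr -subr_ge0.
have := cauchy_schwarz x y; rewrite -subr_ge0 => /(mulr_ge0 (ler0n R 2)).
by congr (_ <= _); ring.
Qed.

Let l2normZ (l : R) (x : L) : l2norm (l *: x) = `|l| * l2norm x.
Proof.
rewrite /l2norm; under eq_bigr do rewrite mxE exprMn.
by rewrite -mulr_sumr sqrtrM ?sqr_ge0// sqrtr_sqr.
Qed.

HB.instance Definition _ :=
  @Lmodule_isNormed.Build R L l2norm ler_l2normD l2normZ l2norm0_eq0.

End l2_normed.

Section banach_mazur.
Context (R : realType).
Local Open Scope ereal_scope.

(* +oo exactly when the linear map f is unbounded. *)
Definition opnorm (V W : normedModType R) (f : V -> W) : \bar R :=
  ereal_sup [set (`|f x|)%:E | x in [set x : V | (`|x| <= 1)%R]].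

(* The multiplicative distance inf ||T|| ||T^-1|| (not its logarithm); it is
   +oo when V and W are not isomorphic. *)
Definition banach_mazur (V W : normedModType R) : \bar R :=
  ereal_inf [set d | exists (T : {linear V -> W}) (T' : {linear W -> V}),
    [/\ continuous T, continuous T', cancel T T', cancel T' T &
        d = opnorm T * opnorm T']].

End banach_mazur.

(* Main.v *)
(* Normalise an isomorphism with [l_2^n] into [S : l_2^n -> C(K)] with
   [|S t| <= |t|] and [|U (S t)| >= c |t|], where [c = b / 2a]. Given unit
   vectors [t_i] with inner products at most [c^2 / 4], the functions
   [f_i = S t_i], soft-thresholded at [c / 2], have [sum_i |f_i| <= 1 / c]
   pointwise, whereas functionals [psi_i] of norm at most 1 factoring through
   [U] still take values at least [c / 2] at them. The matrix [|psi_i|(|f_j|)] then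
   has row sums at most [1 / c], so that a proportion [~ c^2] of the indices
   spans a submatrix with off-diagonal row sums at most [c / 8]; subtracting
   from each [|f_i|] the sum of the other ones makes the supports disjoint at
   a small cost, and gives an isometric copy of [l_infty^j] on which [U] is
   bounded below by [c / 4].

   One may take for [(t_i)] the unit basis, whence [j >= n c^2 / 34], or
   [exp (c^4 n / 128) / 2] greedily chosen sign vectors, whence
   [j >= c^2 exp (c^4 n / 128) / 68]. The product of the two bounds exceeds
   [exp (c^4 n / 128)] as soon as [c^4 n] is large, so one of them is good
   enough. When [c^4 n] is bounded only [j = 2] is needed, and any
   two-dimensional space is at distance less than 2 from [l_infty^2]. *)
From HB Require Import structures.
Require Import Defs.
From mathcomp Require Import all_boot all_order all_algebra.
From mathcomp Require Import all_classical all_reals all_analysis.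
From mathcomp Require Import ring lra zify.
Set Implicit Arguments.
Unset Strict Implicit.
Import Order.TTheory GRing.Theory Num.Theory.
Import numFieldNormedType.Exports.
Local Open Scope ring_scope.

(** * Combinatorial selection *)

Section restriction.
Context (R : realFieldType).

(** A uniformly random colouring keeps each off-diagonal entry with probability [1 / (r + 1)]. This
    is the derandomised form: indices are coloured one after the other, each new one receiving a
    colour whose interaction with the earlier indices is at most the average over all colours. *)
Lemma balanced_colouring (r N : nat) (M : nat -> nat -> R) :
  (forall i, M i i = 0) ->
  exists f : nat -> 'I_r.+1,
    r.+1%:R * (\sum_(i < N) \sum_(j < N | f i == f j) M i j) <=
    \sum_(i < N) \sum_(j < N) M i j.
Proof.
move=> M0; elim: N => [|N [f IH]]; first by exists (fun=> ord0); rewrite !big_ord0 mulr0.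
pose W c := \sum_(i < N | f i == c) (M i N + M N i).
have WT : \sum_c W c = \sum_(i < N) (M i N + M N i).
  by rewrite [RHS](partition_big (fun i : 'I_N => f i) xpredT).
have [c Wc] : exists c, r.+1%:R * W c <= \sum_(i < N) (M i N + M N i).
  apply: contrapT => /forallNP h.
  have : \sum_(c < r.+1) (\sum_(i < N) (M i N + M N i)) <
         \sum_(c < r.+1) r.+1%:R * W c.
    apply: ltr_sum; first by apply/hasP; exists ord0; rewrite ?mem_index_enum.
    by move=> c _; rewrite ltNge; apply/negP/h.
  by rewrite -mulr_sumr WT sumr_const card_ord mulr_natl ltxx.
exists (fun k => if k == N then c else f k).
have nN (i : 'I_N) : (i == N :> nat) = false by rewrite ltn_eqF.
have row (F : nat -> nat -> R) : F N N = 0 ->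
    \sum_(i < N.+1) \sum_(j < N.+1) F i j =
    \sum_(i < N) \sum_(j < N) F i j + \sum_(i < N) (F i N + F N i).
  move=> F0; rewrite big_ord_recr /= big_ord_recr /= F0 addr0.
  under eq_bigr do rewrite big_ord_recr /=.
  by rewrite !big_split /= -addrA.
rewrite (row M)//.
pose F i j := if (if i == N then c else f i) == (if j == N then c else f j)
  then M i j else 0.
rewrite [X in r.+1%:R * X <= _](_ : _ = \sum_(i < N.+1) \sum_(j < N.+1) F i j);
  last by apply: eq_bigr => i _; rewrite big_mkcond.
have FNN : F N N = 0 by rewrite /F !eqxx M0.
rewrite row// /F mulrDr lerD//.
  apply: le_trans IH; rewrite le_eqVlt; apply/orP; left; apply/eqP; congr (_ * _).
  by apply: eq_bigr => i _; rewrite [RHS]big_mkcond; apply: eq_bigr => j _; rewrite !nN.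
apply: le_trans Wc; rewrite le_eqVlt; apply/orP; left; apply/eqP; congr (_ * _).
rewrite /W [RHS]big_mkcond; apply: eq_bigr => i _; rewrite !nN eqxx (eq_sym c).
by case: ifP => _; rewrite ?addr0.
Qed.

(** In a balanced colouring the monochromatic row sums average at most [m / (r + 1)], so by Markov's
    inequality at least half of the rows stay within twice that. The most frequent colour among
    those good rows supplies [I]; discarding bad indices only shrinks sums of nonnegative
    entries. *)
Lemma small_rows_submatrix (r N : nat) (M : nat -> nat -> R) (m : R) :
  0 < m -> (forall i, M i i = 0) -> (forall i j, 0 <= M i j) ->
  (forall i : 'I_N, \sum_(j < N) M i j <= m) ->
  exists I : {set 'I_N}, (N <= 2 * r.+1 * #|I|)%N /\
    forall i, i \in I -> \sum_(j in I) M i j <= 2 * m / r.+1%:R.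
Proof.
move=> m0 Mii Mge0 Mm.
have [f fM] := balanced_colouring r N Mii.
have r0 : 0 < r.+1%:R :> R by [].
pose row (i : 'I_N) := \sum_(j < N | f i == f j) M i j.
pose B := [set i | 2 * m / r.+1%:R < row i].
have row0 i : 0 <= row i by apply: sumr_ge0.
have cardB : (2 * #|B| <= N)%N.
  have h : #|B|%:R * (2 * m / r.+1%:R) <= \sum_i row i.
    rewrite (bigID (mem B)) /= -[leLHS]addr0 lerD ?sumr_ge0//.
    rewrite mulr_natl -sumr_const; apply: ler_sum => i.
    by rewrite inE => /ltW.
  have : r.+1%:R * \sum_i row i <= N%:R * m.
    apply: le_trans fM _; rewrite mulr_natl -[X in _ *+ X]card_ord -sumr_const.
    exact: ler_sum.
  rewrite -(ler_pM2l r0) in h => h2.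
  have := le_trans h h2.
  rewrite (_ : r.+1%:R * _ = (2 * #|B|)%:R * m); last first.
    rewrite natrM; move: r0; set s : R := r.+1%:R => s0.
    by field; rewrite gt_eqF.
  by rewrite ler_pM2r// ler_nat.
pose C c := [set i | (i \notin B) && (f i == c)].
(* Pigeonhole: the classes [C c] partition the good rows. *)
have [c Cc] : exists c, (#|~: B| <= r.+1 * #|C c|)%N.
  apply: contrapT => /forallNP h.
  have sumC : #|~: B| = (\sum_c #|C c|)%N.
    rewrite -sum1_card (partition_big (fun i : 'I_N => f i) xpredT)//=.
    by apply: eq_bigr => c _; rewrite -sum1_card; apply: eq_bigl => i; rewrite !inE.
  have : (\sum_(c < r.+1) (r.+1 * #|C c| + 1) <= \sum_(c < r.+1) #|~: B|)%N.
    by apply: leq_sum => c _; rewrite addn1 ltnNge; apply/negP/h.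
  rewrite big_split /= -big_distrr /= -sumC !sum_nat_const card_ord.
  by move: (r.+1 * _)%N => x; lia.
exists (C c); split.
  have : (#|B| + #|~: B| = N)%N by rewrite cardsC card_ord.
  by move: cardB Cc; rewrite -mulnA; move: (r.+1 * _)%N => x; lia.
move=> i; rewrite inE => /andP[]; rewrite inE -leNgt => rowi /eqP fi.
apply: le_trans rowi; rewrite /row big_mkcond [leRHS]big_mkcond /=.
apply: ler_sum => j _; rewrite !inE fi eq_sym.
by case: ifP => [/andP[_ ->]//|_]; case: ifP.
Qed.

End restriction.

(** * Almost orthogonal sign vectors *)

Section near_orthogonal.
Context (R : realType).

(** A crude form of [cosh s <= exp (s^2 / 2)], drawn from [1 + t <= exp t] alone: the left side is
    at most [1 / (1 - s) + 1 / (1 + s) = 2 / (1 - s^2)], and [1 / (1 - s^2) <= 1 + 2 s^2]. *)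
Lemma expR_add_opp_le (s : R) : s ^+ 2 <= 1 / 2 ->
  expR s + expR (- s) <= 2 * expR (2 * s ^+ 2).
Proof.
move=> s2.
have s1 : -1 < s < 1 by apply/andP; split; nra.
case/andP: s1 => sl su.
have inv (t : R) : t < 1 -> expR t <= (1 - t)^-1.
  move=> t1; rewrite -[t in expR t]opprK expRN lef_pV2 ?posrE ?expR_gt0 ?subr_gt0//.
  exact: expR_ge1Dx.
have h1 := inv s su; have h2 : expR (- s) <= (1 + s)^-1.
  by have := inv (- s); rewrite opprK; apply; lra.
have h3 : (1 - s ^+ 2)^-1 <= expR (2 * s ^+ 2).
  apply: (@le_trans _ _ (1 + 2 * s ^+ 2)); last exact: expR_ge1Dx.
  rewrite -div1r ler_pdivrMr; last lra.
  by have := sqr_ge0 s; nra.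
suff : (1 - s)^-1 + (1 + s)^-1 = 2 * (1 - s ^+ 2)^-1 by move=> h; lra.
field; apply/and3P; split; apply: lt0r_neq0; lra.
Qed.

Section sign_vectors.
Variable n : nat.
Local Notation S := {ffun 'I_n -> bool}.
Implicit Types e d : S.

Let sg (b : bool) : R := (-1) ^+ b.
Definition sgdot e d : R := \sum_i sg (e i) * sg (d i).

Let sgdotC e d : sgdot e d = sgdot d e.
Proof. by apply: eq_bigr => i _; rewrite mulrC. Qed.

Let sg_sqr b : sg b * sg b = 1.
Proof. by case: b; rewrite /sg/= ?expr1 ?expr0 ?mulrNN ?mulr1. Qed.

(** Up to the factor [2^n] this is a moment generating function of a sum of independent signs, so it
    factors over the coordinates. *)
Lemma sum_expR_sgdot (s : R) e : s ^+ 2 <= 1 / 2 ->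
  \sum_d expR (s * sgdot e d) <= (2 * expR (2 * s ^+ 2)) ^+ n.
Proof.
move=> s2.
have -> : \sum_d expR (s * sgdot e d) =
    \prod_(i < n) \sum_b expR (s * (sg (e i) * sg b)).
  rewrite bigA_distr_bigA /=; apply: eq_bigr => d _.
  by rewrite /sgdot mulr_sumr expR_sum.
rewrite -[X in _ ^+ X]card_ord -prodr_const; apply: ler_prod => i _.
rewrite big_bool /= addr_ge0 ?expR_ge0//=.
have -> : sg true = -1 by [].
have -> : sg false = 1 by [].
have := expR_add_opp_le s2; rewrite /sg; case: (e i) => /=;
  rewrite ?expr1 ?expr0 ?mulr1 ?mulrN1 ?mul1r ?opprK ?mulrN ?mulr1//.
by rewrite addrC.
Qed.

(** Chernoff's bound. The exponent [2 s^2 n - s l n] is minimal at [s = l / 4], with value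
    [- l^2 n / 8]; the two tails account for the leading factor 2. *)
Lemma card_correlated (l : R) e : 0 < l <= 1 ->
  #|[set d | l * n%:R <= `|sgdot e d|]|%:R <=
    2 * (2 ^+ n * expR (- (l ^+ 2 * n%:R / 8))) :> R.
Proof.
move=> /andP[l0 l1].
have half (s : R) : s ^+ 2 = (l / 4) ^+ 2 ->
    #|[set d | `|s| * (l * n%:R) <= s * sgdot e d]|%:R <=
    2 ^+ n * expR (- (l ^+ 2 * n%:R / 8)).
  move=> sl.
  have s2 : s ^+ 2 <= 1 / 2 by rewrite sl; nra.
  have sa : `|s| = l / 4.
    by apply/eqP; rewrite -(@eqrXn2 _ 2)// ?real_normK ?num_real ?sl// divr_ge0// ltW.
  have := sum_expR_sgdot e s2; set A := [set d | _].
  have h : #|A|%:R * expR (`|s| * (l * n%:R)) <= \sum_d expR (s * sgdot e d).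
    rewrite (bigID (mem A)) /= -[leLHS]addr0 lerD ?sumr_ge0//.
    rewrite mulr_natl -sumr_const; apply: ler_sum => d.
    by rewrite inE ler_expR.
  move=> /(le_trans h); rewrite -ler_pdivlMr ?expR_gt0// => /le_trans; apply.
  rewrite exprMn -expRM_natr -expRN -(mulrA (2 ^+ n)) -expRD.
  rewrite ler_pM2l ?exprn_gt0//.
  rewrite ler_expR sl sa le_eqVlt; apply/orP; left; apply/eqP; by field.
pose A (s : R) := [set d | `|s| * (l * n%:R) <= s * sgdot e d].
have sub : [set d | l * n%:R <= `|sgdot e d|] \subset A (l / 4) :|: A (- (l / 4)).
  apply/fintype.subsetP => d; rewrite !inE normrN (@gtr0_norm _ (l / 4)); last lra.
  have l4 : 0 < l / 4 by lra.
  rewrite mulNr -mulrN !ler_pM2l//.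
  by rewrite lter_normr.
have := leq_trans (subset_leq_card sub) (leq_card_setU _ _).
rewrite -(ler_nat R) natrD => /le_trans; apply.
rewrite mulr2n mulrDl mul1r lerD//; apply: half => //.
by rewrite sqrrN.
Qed.

(** For a maximal admissible set [A], the sets [B e] of vectors strongly correlated with some [e] in
    [A] cover the cube, and each contains only a small proportion of it. *)
Lemma many_uncorrelated_signs (l : R) : 0 < l <= 1 ->
  exists A : {set S}, expR (l ^+ 2 * n%:R / 8) / 2 <= #|A|%:R /\
    forall e d, e \in A -> d \in A -> e != d -> `|sgdot e d| <= l * n%:R.
Proof.
move=> l01; have /andP[l0 l1] := l01.
pose P (A : {set S}) := [forall e in A, forall d in A,
  (e != d) ==> (`|sgdot e d| <= l * n%:R)].
have [A /maxsetP[PA maxA]] : {A | maxset P A}.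
  by apply: ex_maxset; exists finset.set0; apply/forall_inP => e; rewrite inE.
exists A; split; last first.
  by move=> e d eA dA ed; have /forall_inP/(_ d dA)/implyP := forall_inP PA e eA; apply.
pose B e := [set d | l * n%:R <= `|sgdot e d|].
have cover : [set: S] \subset \bigcup_(e in A) B e.
  apply/fintype.subsetP => d _; apply: contrapT => /negP dB.
  have far e : e \in A -> `|sgdot e d| < l * n%:R.
    move=> eA; rewrite ltNge; apply: contra dB => h.
    by apply/bigcupP; exists e => //; rewrite inE.
  (* A vector is fully correlated with itself, so an uncovered [d] cannot already lie in [A]. *)
  have dd : l * n%:R <= `|sgdot d d|.
    rewrite /sgdot (eq_bigr (fun=> 1)) => [|i _]; last exact: sg_sqr.
    by rewrite sumr_const card_ord ger0_norm// ler_piMl.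
  have dA : d \notin A by apply/negP => /far; rewrite ltNge dd.
  have Pd : P (d |: A).
    apply/forall_inP => x /setU1P xA; apply/forall_inP => y /setU1P yA.
    apply/implyP => xy.
    case: xA xy => [->|xA] xy; case: yA xy => [->|yA] xy.
    - by rewrite eqxx in xy.
    - by rewrite sgdotC ltW// far.
    - by rewrite ltW// far.
    - by have /forall_inP/(_ y yA)/implyP := forall_inP PA x xA; apply.
  have /setP/(_ d) := maxA _ Pd (finset.subsetUr _ _).
  by rewrite !inE eqxx (negbTE dA).
have /subset_leq_card := cover.
rewrite cardsT card_ffun card_bool card_ord => h1.
have h2 : (#|\bigcup_(e in A) B e| <= \sum_(e in A) #|B e|)%N.
  elim/big_rec2 : _ => [|e U k _ ih]; first by rewrite cards0.
  by apply: leq_trans (leq_card_setU _ _) _; rewrite leq_add2l.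
have := leq_trans h1 h2; rewrite -(ler_nat R) natr_sum natrX => /le_trans h3.
have /h3 : \sum_(e in A) #|B e|%:R <=
    \sum_(e in A) 2 * (2 ^+ n * expR (- (l ^+ 2 * n%:R / 8))) :> R.
  by apply: ler_sum => e _; exact: card_correlated.
rewrite sumr_const -[_ *+ #|A|]mulr_natr expRN.
have p : 0 < 2 ^+ n :> R by rewrite exprn_gt0.
set E := expR _ => h4; have E0 : 0 < E by rewrite expR_gt0.
rewrite ler_pdivrMr// -(ler_pM2l p) -ler_pdivlMr//; move: h4.
by congr (_ <= _); ring.
Qed.

End sign_vectors.
End near_orthogonal.

Local Open Scope classical_set_scope.

(** * Norming functionals *)

Definition sublinear (R : realType) (X : lmodType R) (p : X -> R) :=
  (forall x y, p (x + y) <= p x + p y) /\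
  (forall (r : R) x, 0 <= r -> p (r *: x) = r * p x).

Section sublinear_functionals.
Context (R : realType) (X : lmodType R).
Implicit Type p : X -> R.

Lemma sublinear_ge p x : sublinear p -> - p (- x) <= p x.
Proof.
move=> [pD pZ]; have := pD x (- x); rewrite subrr.
have -> : p 0 = 0 by rewrite -(scale0r 0) pZ// mul0r.
by move=> h; lra.
Qed.

(* Largest sublinear functional below [p] with value at most [- p y] at
   [- y]; when [p] is minimal it must coincide with [p]. *)
Definition lower p (y x : X) : R :=
  inf [set p (x + t *: y) - t * p y | t in [set t | 0 <= t]].

Lemma lower_has_inf p y x : sublinear p ->
  has_inf [set p (x + t *: y) - t * p y | t in [set t | 0 <= t]].
Proof.
move=> sp; have [pD pZ] := sp; split; first by exists (p (x + 0 *: y) - 0 * p y), 0 => /=.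
exists (- p (- x)) => _ [t /= t0 <-].
have := pD (x + t *: y) (- x); rewrite addrAC subrr add0r pZ// => h.
lra.
Qed.

Lemma lower_le p y x t : sublinear p -> 0 <= t ->
  lower p y x <= p (x + t *: y) - t * p y.
Proof. by move=> sp t0; apply: ge_inf; [case: (lower_has_inf y x sp)|exists t]. Qed.

Lemma le_lower p y x m : (forall t, 0 <= t -> m <= p (x + t *: y) - t * p y) ->
  m <= lower p y x.
Proof.
move=> h; apply: lb_le_inf; first by exists (p (x + 0 *: y) - 0 * p y), 0 => /=.
by move=> _ [t /= t0 <-]; apply: h.
Qed.

(** For subadditivity, parameters [t] for [x] and [s] for [z] combine into [t + s] for [x + z].
    Homogeneity follows from one inequality, obtained by rescaling [t], applied to [r] and to its
    inverse. *)
Lemma lower_sublinear p y : sublinear p -> sublinear (lower p y).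
Proof.
move=> sp; have [pD pZ] := sp; split=> [x z|r x].
  suff : lower p y (x + z) - lower p y z <= lower p y x by move=> h; lra.
  apply: le_lower => t t0.
  suff : lower p y (x + z) - (p (x + t *: y) - t * p y) <= lower p y z.
    by move=> h; lra.
  apply: le_lower => s s0.
  have := lower_le y (x + z) sp (addr_ge0 t0 s0).
  have := pD (x + t *: y) (z + s *: y).
  rewrite addrACA -scalerDl => h1 h2; lra.
rewrite le_eqVlt => /predU1P[<-|r0].
  rewrite scale0r mul0r; apply/eqP; rewrite eq_le; apply/andP; split.
    have := lower_le y 0 sp (lexx 0); rewrite scale0r addr0 mul0r subr0.
    by rewrite -[X in p X](scale0r 0) pZ// mul0r.
  by apply: le_lower => t t0; rewrite add0r pZ// subrr.
have le (s : R) z : 0 < s -> s * lower p y z <= lower p y (s *: z).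
  move=> s0; apply: le_lower => t t0.
  have t's : 0 <= t / s by rewrite divr_ge0// ltW.
  have := lower_le y z sp t's.
  rewrite -(ler_pM2l s0) mulrBr -pZ ?(ltW s0)// scalerDr scalerA.
  suff -> : s * (t / s * p y) = t * p y by rewrite mulrCA divff ?gt_eqF ?mulr1.
  by rewrite mulrA mulrCA divff ?gt_eqF ?mulr1.
apply/eqP; rewrite eq_le le// andbT.
have ri : 0 < r^-1 by rewrite invr_gt0.
have := le r^-1 (r *: x) ri.
by rewrite scalerA mulVf ?gt_eqF// scale1r ler_pdivrMl.
Qed.

(** The core of the Hahn-Banach theorem: Zorn's lemma yields a minimal sublinear functional below
    [p], and minimal ones are linear. *)
Lemma exists_linear_below p : sublinear p ->
  exists g : {scalar X}, forall x, g x <= p x.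
Proof.
move=> sp.
pose T := {q : X -> R | sublinear q /\ forall x, q x <= p x}.
(* The pointwise order is reversed, so that Zorn's maximal element is a minimal functional. *)
pose le (q r : T) := `[< forall x, sval r x <= sval q x >].
have [|||A Atot|[q [sq qp]] qmin] := @Zorn T le.
- by move=> q; apply/asboolP.
- move=> q r s /asboolP h1 /asboolP h2; apply/asboolP => x.
  exact: le_trans (h2 x) (h1 x).
- move=> [q Hq] [r Hr] /asboolP/= h1 /asboolP/= h2; apply: eq_exist => //=.
  by apply/funext => x; apply/eqP; rewrite eq_le h1 h2.
- have [[q0 Aq0]|A0] := pselect (exists r, A r); last first.
    have Hp : sublinear p /\ forall x, p x <= p x by [].
    by exists (exist _ p Hp) => s As; case: A0; exists s.
  pose S x := [set sval q x | q in A].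
  have Slb x (q : T) : A q -> - p (- x) <= sval q x.
    move=> Aq; have [sq qp] := svalP q.
    by apply: le_trans (sublinear_ge x sq); rewrite lerN2.
  have Sinf x : has_inf (S x).
    split; first by exists (sval q0 x), q0.
    by exists (- p (- x)) => _ [q Aq <-]; exact: Slb.
  (* The pointwise infimum of a nonempty chain is subadditive because, of two members of the chain,
     the smaller one serves both [x] and [y]. *)
  pose m x := inf (S x).
  have mle x q : A q -> m x <= sval q x.
    by move=> Aq; apply: ge_inf; [case: (Sinf x)|exists q].
  have lem x r : (forall q, A q -> r <= sval q x) -> r <= m x.
    by move=> h; apply: lb_le_inf; [case: (Sinf x)|move=> _ [q Aq <-]; exact: h].
  have msub : sublinear m.
    split=> [x y|r x r0].
      suff : m (x + y) - m y <= m x by move=> h; lra.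
      apply: (lem x) => q Aq.
      suff : m (x + y) - sval q x <= m y by move=> h; lra.
      apply: (lem y) => q' Aq'.
      have [/asboolP qq'|/asboolP qq'] := Atot _ _ Aq Aq'.
        have := mle (x + y) _ Aq'; have [[qD _] _] := svalP q'.
        by move: (qD x y) (qq' x) => h1 h2 h3; lra.
      have := mle (x + y) _ Aq; have [[qD _] _] := svalP q.
      by move: (qD x y) (qq' y) => h1 h2 h3; lra.
    have [->|rn0] := eqVneq r 0.
      rewrite scale0r mul0r; apply/eqP; rewrite eq_le; apply/andP; split.
        have := mle 0 _ Aq0; have [[_ qZ] _] := svalP q0.
        by rewrite -[X in sval q0 X](scale0r 0) qZ// mul0r.
      apply: lem => q Aq; have [[_ qZ] _] := svalP q.
      by rewrite -(scale0r 0) qZ// mul0r.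
    have rp : 0 < r by rewrite lt_neqAle eq_sym rn0.
    apply/eqP; rewrite eq_le; apply/andP; split.
      rewrite -ler_pdivrMl//; apply: lem => q Aq.
      by rewrite ler_pdivrMl//; have [[_ <-//] _] := svalP q; exact: mle.
    apply: lem => q Aq; have [[_ ->//] _] := svalP q.
    by rewrite ler_pM2l//; exact: mle.
  have mp : sublinear m /\ forall x, m x <= p x.
    by split=> // x; have [_ qp] := svalP q0; exact: le_trans (mle x _ Aq0) (qp x).
  exists (exist _ m mp) => s As; apply/asboolP => x /=; exact: mle.
have [qD qZ] := sq.
have addq x y : q (x + y) = q x + q y.
  apply/eqP; rewrite eq_le qD/=.
  have Hl : sublinear (lower q y) /\ forall x, lower q y x <= p x.
    split=> [|z]; first exact: lower_sublinear.
    apply: le_trans (qp z); have := lower_le y z sq (lexx 0).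
    by rewrite scale0r addr0 mul0r subr0.
  (* Minimality gives [lower q y = q]; the parameter [t = 1] in the infimum then reads
     [q x <= q (x + y) - q y]. *)
  have /qmin/(congr1 sval)/= lq : le (exist _ q (conj sq qp)) (exist _ _ Hl).
    apply/asboolP => z /=; have := lower_le y z sq (lexx 0).
    by rewrite scale0r addr0 mul0r subr0.
  have := lower_le y x sq ler01; rewrite lq scale1r mul1r => h; lra.
have q0 : q 0 = 0 by rewrite -(scale0r 0) qZ// mul0r.
have qN x : q (- x) = - q x.
  by apply/eqP; rewrite -addr_eq0 -addq addNr q0.
have linq : linear_for *%R q.
  move=> r x y; rewrite addq; congr (_ + _).
  have [r0|r0] := leP 0 r; first exact: qZ.
  rewrite -[r]opprK scaleNr qN qZ ?mulNr//; lra.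
pose g : {scalar X} := HB.pack q (GRing.isLinear.Build R X R *%R q linq).
by exists g.
Qed.

End sublinear_functionals.

(** A linear functional below [lower] of the norm in direction [x0] is below the norm, and at [- x0]
    the parameter [t = 1] bounds it by [- |x0|]. *)
Lemma norming_functional (R : realType) (X : normedModType R) (x0 : X) :
  exists g : {scalar X}, (forall x, g x <= `|x|) /\ g x0 = `|x0|.
Proof.
have sN : sublinear (fun x : X => `|x|).
  by split=> [x y|r x r0]; [exact: ler_normD|rewrite normrZ ger0_norm].
have [g gl] := exists_linear_below (lower_sublinear x0 sN).
have gN x : g x <= `|x|.
  apply: le_trans (gl x) _; have := lower_le x0 x sN (lexx 0).
  by rewrite scale0r addr0 mul0r subr0.
exists g; split=> //; apply/eqP; rewrite eq_le gN/=.
have := le_trans (gl (- x0)) (lower_le x0 (- x0) sN ler01).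
by rewrite scale1r addNr normr0 mul1r linearN /= => h; lra.
Qed.

(** * Subspaces close to [l_infty^j] *)

Section banach_mazur_bounds.
Context (R : realType).
Implicit Types V W : normedModType R.

Lemma opnorm_le V W (f : V -> W) (M : R) :
  (forall x, `|x| <= 1 -> `|f x| <= M) -> (opnorm f <= M%:E)%E.
Proof. by move=> fM; apply: ge_ereal_sup => _ [x /= x1 <-]; rewrite lee_fin fM. Qed.

Lemma opnorm_ge0 V W (f : V -> W) : (0 <= opnorm f)%E.
Proof.
apply: le_trans (_ : ((`|f 0|)%:E <= _)%E); first by rewrite lee_fin.
by apply: ereal_sup_ubound; exists 0 => //=; rewrite normr0.
Qed.

Lemma opnormP V W (f : {linear V -> W}) (M : R) (x : V) :
  (opnorm f <= M%:E)%E -> `|f x| <= M * `|x|.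
Proof.
move=> fM; have [->|x0] := eqVneq x 0; first by rewrite linear0 !normr0 mulr0.
have nx : 0 < `|x| by rewrite normr_gt0.
have : ((`|f (`|x|^-1 *: x)|)%:E <= M%:E)%E.
  apply: le_trans fM; apply: ereal_sup_ubound; exists (`|x|^-1 *: x) => //=.
  by rewrite normrZ normfV normr_id mulVf// gt_eqF.
by rewrite lee_fin linearZ normrZ normfV normr_id ler_pdivrMl// mulrC.
Qed.

Lemma bounded_linear V W (f : {linear V -> W}) (M : R) :
  (forall x, `|f x| <= M * `|x|) -> continuous f.
Proof.
move=> fM; apply/bounded_linear_continuous/linear_boundedP.
exists M; split=> [|r Mr x]; first exact: num_real.
by apply: le_trans (fM x) _; rewrite ler_wpM2r// ltW.
Qed.

End banach_mazur_bounds.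

Section span.
Context (R : realType) (V : normedModType R) (j : nat) (h : 'I_j -> V).

Definition lincomb (a : 'rV[R]_j) : V := \sum_(i < j) a 0 i *: h i.

Fact lincomb_linear : linear lincomb.
Proof.
move=> r a b; rewrite /lincomb scaler_sumr -big_split; apply: eq_bigr => i _ /=.
by rewrite !mxE scalerDl scalerA.
Qed.
HB.instance Definition _ :=
  GRing.isLinear.Build R 'rV[R]_j V _ lincomb lincomb_linear.

Definition span_pred : {pred V} := mem (range lincomb).

Fact span_submod_closed : submod_closed span_pred.
Proof.
split=> [|r x y]; rewrite !inE; first by exists 0 => //; rewrite linear0.
by move=> [a _ <-] [b _ <-]; exists (r *: a + b) => //; rewrite linearP.
Qed.
HB.instance Definition _ :=
  GRing.isSubmodClosed.Build R V span_pred span_submod_closed.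

Definition span : submodClosed V := span_pred.

Lemma spanP x : x \in span -> exists a, x = lincomb a.
Proof. by rewrite inE => -[a _ <-]; exists a. Qed.

(** The coefficient map and its inverse have norms at most [1 / m] and [M], with product below 2.
    The lower estimate also makes the coefficients unique. *)
Lemma banach_mazur_span (m M : R) : 0 < m -> M < 2 * m ->
  (forall a : 'rV[R]_j, m * `|a| <= `|lincomb a| <= M * `|a|) ->
  (banach_mazur (subsp span) (linfty R j) < 2%:E)%E.
Proof.
move=> m0 Mm hmM.
have lin0 a : lincomb a = 0 -> a = 0.
  move=> a0; have /andP[+ _] := hmM a; rewrite a0 normr0.
  by rewrite pmulr_rle0// normr_le0 => /eqP.
have inspan a : lincomb a \in span by rewrite inE; exists a.
pose T' (a : linfty R j) : subsp span := Subsp (inspan a).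
have linT' : linear T' by move=> r a b; apply: val_inj; rewrite /= linearP.
pose T'L : {linear linfty R j -> subsp span} :=
  HB.pack T' (GRing.isLinear.Build R _ _ _ T' linT').
pose T (x : subsp span) : linfty R j := projT1 (cid (spanP (subspP x))).
have TK : cancel T T'.
  by move=> x; apply: val_inj; rewrite /= /T; case: cid.
have T'K : cancel T' T.
  move=> a; apply/eqP; rewrite -subr_eq0; apply/eqP/lin0.
  by rewrite linearB; have /= -> := congr1 val (TK (T' a)); rewrite subrr.
have linT : linear T.
  by move=> r x y; apply: (can_inj T'K); rewrite linT' !TK.
pose TL : {linear subsp span -> linfty R j} :=
  HB.pack T (GRing.isLinear.Build R _ _ _ T linT).
have T'M a : `|T' a| <= M * `|a| by have /andP[] := hmM a.
have Tm x : `|T x| <= m^-1 * `|x|.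
  by rewrite -{2}(TK x) ler_pdivlMl//; have /andP[] := hmM (T x).
apply: (@le_lt_trans _ _ (opnorm TL * opnorm T'L)%E).
  apply: ereal_inf_lbound; exists TL, T'L; split=> //.
    exact: (bounded_linear (f := TL) Tm).
  exact: (bounded_linear (f := T'L) T'M).
have M0 : 0 <= M \/ forall a : linfty R j, `|a| = 0.
  have [|M0] := leP 0 M; [by left|right => a; apply/eqP].
  rewrite eq_le normr_ge0 andbT; have := T'M a => h1.
  rewrite -(nmulr_rge0 _ M0); exact: le_trans h1.
(* For [j = 0] the hypotheses allow a negative [M], hence the maximum with 0, which is still below
   [2 * m]. *)
have oT' : (opnorm T'L <= (Num.max 0 M)%:E)%E.
  apply: opnorm_le => a a1; apply: le_trans (T'M a) _.
  rewrite (@le_trans _ _ (Num.max 0 M * `|a|))//.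
    by rewrite ler_wpM2r// le_max lexx orbT.
  by rewrite ler_piMr// le_max lexx.
have oT : (opnorm TL <= m^-1%:E)%E.
  apply: opnorm_le => x x1; apply: le_trans (Tm x) _.
  by rewrite ler_piMr// invr_ge0 ltW.
apply: (@le_lt_trans _ _ (m^-1%:E * (Num.max 0 M)%:E)%E).
  by apply: lee_pmul => //; exact: opnorm_ge0.
rewrite -EFinM lte_fin ltr_pdivrMl// mulrC gt_max.
by rewrite mulr_gt0//= Mm.
Qed.

End span.

(** * Disjoint functions in [C(K)] *)

Section continuous_functions.
Context (R : realType) (K : topologicalType) (cptK : compact [set: K]).
Local Notation C := (contfun R cptK).
Implicit Types f g p : C.

Lemma normr_contfun_le f x : `|f x| <= `|f|.
Proof.
have [M [_ /(_ (M + 1))]] : bounded_set (contfun_val f @` [set: K]).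
  apply/compact_bounded/continuous_compact => //.
  by apply: continuous_subspaceT; move: (contfunP f); rewrite inE.
rewrite ltrDl ltr01 => /(_ isT) Mf.
apply: ub_le_sup; last by exists x.
by exists (M + 1) => _ [y _ <-]; apply: Mf; exists y.
Qed.

Lemma contfun_norm_le f (M : R) : 0 <= M -> (forall x, `|f x| <= M) -> `|f| <= M.
Proof.
move=> M0 fM; have [[k _]|/set0P/negP/negPn/eqP K0] := pselect ([set: K] !=set0).
  by apply: ge_sup => [|_ [x _ <-]//]; exists `|f k|, k.
have -> : `|f| = supnorm f by [].
by rewrite /supnorm K0 image_set0 sup0.
Qed.

Lemma contfun_continuous f : continuous f.
Proof. by move: (contfunP f); rewrite inE. Qed.

Definition contfun_of (F : K -> R) (cF : continuous F) : C :=
  ContFun cptK (mem_set cF : F \in @contfun_pred R K).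

Lemma contfunD f g x : (f + g) x = f x + g x. Proof. by []. Qed.
Lemma contfunN f x : (- f) x = - f x. Proof. by []. Qed.
Lemma contfunZ (r : R) f x : (r *: f) x = r * f x. Proof. by []. Qed.
Lemma contfun0 x : (0 : C) x = 0. Proof. by []. Qed.
Lemma contfun_sum (I : Type) (r : seq I) (P : pred I) (F : I -> C) x :
  (\sum_(i <- r | P i) F i) x = \sum_(i <- r | P i) F i x.
Proof. by elim/big_rec2 : _ => // i y z _ <-. Qed.

Lemma contfun_abs_subproof f : continuous (fun x => `|f x|).
Proof. by move=> x; apply: cvg_norm; exact: contfun_continuous. Qed.
Definition contfun_abs f : C := contfun_of (@contfun_abs_subproof f).

Lemma contfun_cst_subproof (r : R) : continuous (fun _ : K => r).
Proof. by move=> x; exact: cvg_cst. Qed.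
Definition contfun_cst (r : R) : C := contfun_of (@contfun_cst_subproof r).

Lemma clamp_subproof f p : continuous (fun x => Num.max (Num.min (f x) (p x)) (- p x)).
Proof.
move=> x; have cp := @contfun_continuous p x.
apply: (@continuous_max _ _ (f \min p) (\- p) x); last exact: cvgN.
exact: (@continuous_min _ _ f p x (@contfun_continuous f x)).
Qed.
(** For [p >= 0] this truncates [f] to values between [- p] and [p], so that [f - clamp f p] is [f]
    soft-thresholded at the variable level [p]. *)
Definition clamp f p : C := contfun_of (@clamp_subproof f p).

Lemma clampE f p x : clamp f p x = Num.max (Num.min (f x) (p x)) (- p x).
Proof. by []. Qed.

Lemma normr_clamp_le f p x : 0 <= p x -> `|clamp f p x| <= p x.
Proof.
by move=> p0; rewrite clampE ler_norml le_max lexx orbT/= ge_max ge_min lexx orbT/=; lra.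
Qed.

Lemma normr_subr_clamp f p x : 0 <= p x ->
  `|(f - clamp f p) x| = Num.max (`|f x| - p x) 0.
Proof.
move=> p0; rewrite contfunD contfunN clampE.
have [h1|h1] := leP (f x) (p x).
  have [h2|h2] := leP (f x) (- p x).
    rewrite max_l; last by rewrite ler0_norm; lra.
    by rewrite !ler0_norm; lra.
  rewrite subrr normr0 max_r// subr_le0 ler_norml; apply/andP; split; lra.
by rewrite (@max_l _ _ (p x)) ?max_l ?ger0_norm//; lra.
Qed.

Section variation.
Variable psi : {scalar C}.
Hypothesis psi1 : forall f, psi f <= `|f|.

(* The total variation measure of [psi], evaluated at [h >= 0]. *)
Definition variation (h : K -> R) : R :=
  sup [set psi g | g in [set g : C | forall x, `|g x| <= h x]].

Lemma variation_has_sup (h : C) : (forall x, 0 <= h x) ->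
  has_sup [set psi g | g in [set g : C | forall x, `|g x| <= h x]].
Proof.
move=> h0; split; first by exists (psi 0), 0 => // x; rewrite contfun0 normr0.
exists `|h| => _ [g /= gh <-]; apply: le_trans (psi1 g) _.
apply: contfun_norm_le => // x; apply: le_trans (gh x) _.
by rewrite (le_trans (ler_norm _))// normr_contfun_le.
Qed.

Lemma variation_ge (h g : C) : (forall x, `|g x| <= h x) -> psi g <= variation h.
Proof.
move=> gh; apply: ub_le_sup; last by exists g.
by case: (variation_has_sup (fun x => le_trans (normr_ge0 _) (gh x))).
Qed.

Lemma variation_ge0 (h : C) : (forall x, 0 <= h x) -> 0 <= variation h.
Proof.
move=> h0; rewrite -(linear0 psi); apply: variation_ge => x.
by rewrite contfun0 normr0.
Qed.

(** Near-optimal [g i] for the separate suprema add up to a function of norm at most [m], on which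
    [psi] is at most [m]. *)
Lemma sum_variation_le (N : nat) (h : 'I_N -> C) (m : R) : 0 <= m ->
  (forall i x, 0 <= h i x) -> (forall x, \sum_i h i x <= m) ->
  \sum_i variation (h i) <= m.
Proof.
move=> m0 h0 hm; apply/ler_addgt0Pr => e e0.
have [g gP] : {g : 'I_N -> C & forall i, (forall x, `|g i x| <= h i x) /\
    variation (h i) < psi (g i) + e / N.+1%:R}.
  apply: (choice (P := fun (i : 'I_N) (gi : C) => (forall x, `|gi x| <= h i x) /\
    variation (h i) < psi gi + e / N.+1%:R)) => i.
  (* Dividing by [N.+1] keeps the total error at most [e] and covers [N = 0]. *)
  have eN : 0 < e / N.+1%:R by rewrite divr_gt0.
  have [_ [g /= gh <-] lt] := sup_adherent eN (variation_has_sup (h0 i)).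
  by exists g; split=> //; rewrite -ltrBlDr.
apply: (@le_trans _ _ (\sum_i (psi (g i) + e / N.+1%:R))).
  by apply: ler_sum => i _; apply: ltW; have [] := gP i.
rewrite big_split /= sumr_const card_ord lerD//.
  rewrite -linear_sum; apply: le_trans (psi1 _) _; apply: contfun_norm_le => // x.
  rewrite contfun_sum; apply: le_trans (ler_norm_sum _ _ _) _.
  by apply: le_trans (hm x); apply: ler_sum => i _; have [] := gP i.
rewrite -[leLHS]mulr_natr -mulrA ler_piMr ?ltW// mulrC.
by rewrite ltr_pdivrMr// mul1r ltr_nat.
Qed.

(** Riesz decomposition: [clamp g (h i)] is dominated by [h i], and what remains of [g] by the other
    terms. *)
Lemma le_sum_variation (I : Type) (s : seq I) (P : pred I) (h : I -> C) (g : C) :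
  (forall i x, 0 <= h i x) -> (forall x, `|g x| <= \sum_(i <- s | P i) h i x) ->
  psi g <= \sum_(i <- s | P i) variation (h i).
Proof.
move=> h0; elim: s g => [|i s IH] g gh.
  rewrite big_nil (_ : g = 0) ?linear0//; apply/val_inj/funext => x.
  by apply/eqP; rewrite -normr_le0; have := gh x; rewrite big_nil.
rewrite big_cons; case: ifP => Pi; last first.
  by apply: IH => x; have := gh x; rewrite big_cons Pi.
rewrite -(subrK (clamp g (h i)) g) addrC linearD lerD//.
  by apply: variation_ge => x; exact: normr_clamp_le.
apply: IH => x; rewrite normr_subr_clamp// ge_max sumr_ge0// andbT.
by have := gh x; rewrite big_cons Pi => ghx; lra.
Qed.

End variation.
End continuous_functions.

(** * Making functions disjoint while keeping their images under [U] large *)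

Section disjointification.
Context (R : realType) (K : topologicalType) (cptK : compact [set: K]).
Local Notation C := (contfun R cptK).
Context (X : normedModType R) (U : {linear C -> X}).
Hypothesis U1 : forall f, `|U f| <= `|f|.

(** The functional [psi i] is at least [c] at [f i]. It loses at most [c / 2] by thresholding,
    [c / 8] by disjointification and [c / 8] to the other summands, which leaves [c / 4]. *)
Lemma disjoint_bumps (N r : nat) (f : nat -> C) (c m : R) :
  0 < c -> 0 < m -> 2 * m / r.+1%:R <= c / 8 ->
  (forall i : 'I_N, c <= `|U (f i)|) ->
  (forall i : 'I_N, `|f i| <= 1) ->
  (forall x, \sum_(i < N) Num.max (`|f i x| - c / 2) 0 <= m) ->
  exists (I : {set 'I_N}) (h : 'I_N -> C),
    [/\ (N <= 2 * r.+1 * #|I|)%N,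
        forall i j, i \in I -> j \in I -> i != j -> forall x, h i x = 0 \/ h j x = 0,
        forall i, i \in I -> `|h i| <= 1 &
        forall i (b : 'I_N -> R), i \in I -> b i = 1 -> (forall j, `|b j| <= 1) ->
          c / 4 <= `|U (\sum_(j in I) b j *: h j)|].
Proof.
move=> c0 m0 rm Uf f1 fm.
pose phi i : {scalar X} := projT1 (cid (norming_functional (U (f i)))).
have phi1 i x : phi i x <= `|x| by rewrite /phi; case: cid => /= ? [].
have phif i : phi i (U (f i)) = `|U (f i)| by rewrite /phi; case: cid => /= ? [].
pose psi i : {scalar C} := phi i \o U.
have psi1 i g : psi i g <= `|g| by apply: le_trans (phi1 i _) (U1 _).
pose p := contfun_cst cptK (c / 2).
have p0 x : 0 <= p x by rewrite divr_ge0// ltW.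
pose g i : C := f i - clamp (f i) p.
have gE i x : `|g i x| = Num.max (`|f i x| - c / 2) 0 by exact: normr_subr_clamp.
pose q i : C := contfun_abs (g i).
have q0 i x : 0 <= q i x by exact: normr_ge0.
(* Total variations rather than values of [psi i] are recorded, since the functions met later are
   only known to be dominated by sums of the [q j]. *)
pose M (i j : nat) := if i == j then 0 else variation (psi i) (q j).
have Mii i : M i i = 0 by rewrite /M eqxx.
have Mge0 i j : 0 <= M i j by rewrite /M; case: ifP => // _; exact: variation_ge0.
have Mm (i : 'I_N) : \sum_(j < N) M i j <= m.
  apply: le_trans (_ : _ <= \sum_(j < N) variation (psi i) (q j)) _.
    by apply: ler_sum => j _; rewrite /M; case: ifP => // _; exact: variation_ge0.
  apply: (sum_variation_le (psi1 i) (ltW m0)) => // x.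
  by apply: le_trans (fm x); apply: ler_sum => j _; rewrite -gE.
have [I [NI MI]] := small_rows_submatrix r m0 Mii Mge0 Mm.
pose P (i : 'I_N) : C := \sum_(j in I | j != i) q j.
have PE i x : P i x = \sum_(j in I | j != i) `|g j x| by rewrite /P contfun_sum.
have P0 i x : 0 <= P i x by rewrite PE sumr_ge0.
(* At any point [h i] survives only if [|g i|] exceeds the sum of all other [|g j|], which happens
   for at most one index of [I]. *)
pose h (i : 'I_N) : C := g i - clamp (g i) (P i).
have hE i x : `|h i x| = Num.max (`|g i x| - P i x) 0 by exact: normr_subr_clamp.
have hg i x : `|h i x| <= `|g i x|.
  by rewrite hE ge_max normr_ge0 andbT lerBlDr lerDl.
have row i : i \in I -> forall y : C, (forall x, `|y x| <= P i x) -> psi i y <= c / 8.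
  move=> iI y yP; apply: le_trans (_ : _ <= \sum_(j in I | j != i) variation (psi i) (q j)) _.
    by apply: (le_sum_variation (psi1 i)) => // x; rewrite -contfun_sum; exact: yP.
  apply: le_trans rm; apply: le_trans (MI i iI).
  rewrite [leRHS](bigD1 i)//= Mii add0r; apply: ler_sum => j /andP[_ ji].
  by rewrite /M val_eqE eq_sym (negbTE ji).
exists I, h; split=> //.
- move=> i j iI jI ij x.
  have [gij|gij] := leP `|g i x| `|g j x|; [left|right].
    apply/eqP; rewrite -normr_le0 hE ge_max lexx andbT subr_le0.
    apply: le_trans gij _; rewrite PE (bigD1 j) /=; last by rewrite jI eq_sym.
    by rewrite lerDl sumr_ge0.
  apply/eqP; rewrite -normr_le0 hE ge_max lexx andbT subr_le0.
  apply: le_trans (ltW gij) _; rewrite PE (bigD1 i) /=; last by rewrite iI.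
  by rewrite lerDl sumr_ge0.
- move=> i iI; apply: contfun_norm_le => // x; apply: le_trans (hg i x) _.
  rewrite gE ge_max ler01 andbT; have := le_trans (normr_contfun_le (f i) x) (f1 i).
  by move=> ?; lra.
move=> i b iI bi b1; set y := \sum_(j in I) _.
apply: le_trans (phi1 i (U y)); change (c / 4 <= psi i y).
pose z := \sum_(j in I | j != i) b j *: h j.
have -> : y = f i - clamp (f i) p - (clamp (g i) (P i) + (- z)).
  rewrite /y (bigD1 i)//= bi scale1r opprD opprK addrA; congr (_ + _).
have e1 : psi i (clamp (f i) p) <= c / 2.
  apply: le_trans (psi1 _ _) _; apply: contfun_norm_le => [|x]; first by rewrite divr_ge0// ltW.
  exact: (normr_clamp_le (f i) (p0 x)).
have e2 : psi i (clamp (g i) (P i)) <= c / 8.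
  by apply: row => // x; exact: normr_clamp_le.
have e3 : psi i (- z) <= c / 8.
  apply: row => // x; rewrite contfunN normrN /z contfun_sum PE.
  apply: le_trans (ler_norm_sum _ _ _) _; apply: ler_sum => j _.
  rewrite contfunZ normrM; apply: le_trans (hg j x).
  by rewrite ler_piMl.
have e4 : c <= psi i (f i) by rewrite /psi/= phif.
by rewrite linearB linearD linearB /=; lra.
Qed.

(** Normalised disjoint functions span [l_infty] isometrically. For the lower bound on [U], dividing
    by the largest coefficient gives a combination to which the last hypothesis applies. *)
Lemma linfty_copy (N : nat) (I : {set 'I_N}) (h : 'I_N -> C) (d : R) : 0 < d ->
  (forall i j, i \in I -> j \in I -> i != j -> forall x, h i x = 0 \/ h j x = 0) ->
  (forall i, i \in I -> `|h i| <= 1) ->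
  (forall i (b : 'I_N -> R), i \in I -> b i = 1 -> (forall j, `|b j| <= 1) ->
     d <= `|U (\sum_(j in I) b j *: h j)|) ->
  exists h' : 'I_#|I| -> C, forall a : 'rV_#|I|,
    `|lincomb h' a| = `|a| /\ d * `|a| <= `|U (lincomb h' a)|.
Proof.
move=> d0 disj h1 hU.
have hn i : i \in I -> 0 < `|h i|.
  move=> iI; apply: lt_le_trans d0 _.
  have := hU i (fun j => (j == i)%:R) iI; rewrite eqxx => /(_ erefl).
  rewrite (bigD1 i)//= eqxx scale1r big1 ?addr0 => [|j /andP[_ /negbTE->]]; last first.
    by rewrite scale0r.
  move=> hh; apply: le_trans (U1 _); apply: hh => j.
  by case: eqP => _; rewrite ?normr1 ?normr0.
pose e (k : 'I_#|I|) : 'I_N := enum_val k.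
have eI k : e k \in I by exact: enum_valP.
exists (fun k => `|h (e k)|^-1 *: h (e k)) => a.
have coef k : `|a 0 k| <= `|a|.
  by rewrite [leRHS]/Num.norm/= mx_normrE; apply/bigmax_geP; right => /=; exists (0, k).
have aub (m : R) : 0 <= m -> (forall k, `|a 0 k| <= m) -> `|a| <= m.
  move=> m0 am; rewrite [leLHS]/Num.norm/= mx_normrE; apply/bigmax_leP; split=> //= -[i k] _ /=.
  by rewrite ord1.
(* These are the coefficients relative to the original [h]; as [|h (e k)| <= 1], they dominate those
   of [a]. *)
pose b k := a 0 k / `|h (e k)|.
have linE : lincomb (fun k => `|h (e k)|^-1 *: h (e k)) a = \sum_k b k *: h (e k).
  by apply: eq_bigr => k _; rewrite scalerA.
have ab k : `|a 0 k| <= `|b k|.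
  rewrite /b normrM normfV normr_id ler_pdivlMr ?hn//.
  by rewrite ler_piMr// h1.
have bh k : b k * `|h (e k)| = a 0 k by rewrite /b divfK// gt_eqF// hn.
clearbody b; rewrite linE; split.
  apply/eqP; rewrite eq_le; apply/andP; split.
    apply: contfun_norm_le => // x; rewrite contfun_sum.
    have [[k hk]|none] := pselect (exists k, h (e k) x != 0).
      rewrite (bigD1 k)//= big1 ?addr0 => [|l lk].
        change (`|b k * h (e k) x| <= `|a|); rewrite normrM; apply: le_trans (coef k).
        rewrite -(bh k) normrM normr_id ler_wpM2l//; exact: normr_contfun_le.
      change (b l * h (e l) x = 0); have [|->|/eqP] := disj (e l) (e k) (eI _) (eI _) _ x.
      - by apply: contra lk => /eqP/enum_val_inj ->.
      - by rewrite mulr0.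
      - by rewrite (negbTE hk).
    rewrite big1 ?normr0// => k _; rewrite contfunZ.
    have [->|hk] := eqVneq (h (e k) x) 0; first by rewrite mulr0.
    by case: none; exists k.
  apply: aub => // k; rewrite -(bh k) normrM normr_id.
  have [b0|b0] := eqVneq (b k) 0; first by rewrite b0 normr0 mul0r.
  rewrite -ler_pdivlMl ?normr_gt0//; apply: contfun_norm_le => [|x].
    by rewrite mulr_ge0// invr_ge0.
  rewrite ler_pdivlMl ?normr_gt0// -normrM.
  have [->|hk] := eqVneq (h (e k) x) 0; first by rewrite mulr0 normr0.
  apply: le_trans (normr_contfun_le _ x); rewrite contfun_sum (bigD1 k)//=.
  rewrite big1 ?addr0// => l lk.
  change (b l * h (e l) x = 0); have [|->|/eqP] := disj (e l) (e k) (eI _) (eI _) _ x.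
  - by apply: contra lk => /eqP/enum_val_inj ->.
  - by rewrite mulr0.
  - by rewrite (negbTE hk).
have [a0|/eqP a0] := eqVneq a 0; first by rewrite a0 normr0 mulr0.
have [k0 _] : exists k : 'I_#|I|, True.
  apply: contrapT => /forallNP hk; apply: a0; apply/rowP => k; by case: (hk k).
pose k := [arg max_(k > k0) `|b k|]%O.
have kmax l : `|b l| <= `|b k| by rewrite /k; case: arg_maxP => // i _; apply.
have ak : `|a| <= `|b k|.
  by apply: aub => // l; apply: le_trans (ab l) (kmax l).
have bk0 : b k != 0.
  by rewrite -normr_gt0; apply: lt_le_trans ak; rewrite normr_gt0; apply/eqP.
apply: (@le_trans _ _ (`|b k| * d)); first by rewrite mulrC ler_wpM2r// ltW.
rewrite -ler_pdivlMl ?normr_gt0// -normfV -normrZ -linearZ /= scaler_sumr.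
(* Extension by zero of the rescaled coefficients from the enumeration of [I] to all indices. *)
pose b' (i : 'I_N) := if [pick l | e l == i] is Some l then (b k)^-1 * b l else 0.
have b'e l : b' (e l) = (b k)^-1 * b l.
  rewrite /b'; case: pickP => [l' /eqP /enum_val_inj -> //|/(_ l)].
  by rewrite eqxx.
rewrite (_ : \sum_l _ = \sum_(i in I) b' i *: h i).
  apply: (hU (e k)) => //; first by rewrite b'e mulVf.
  move=> j; rewrite /b'; case: pickP => [l _|_]; last by rewrite normr0.
  by rewrite normrM normfV ler_pdivrMl ?normr_gt0// mulr1.
rewrite [RHS]big_enum_val; apply: eq_bigr => l _.
by rewrite -/(e l) b'e scalerA.
Qed.

End disjointification.

(** * Two-dimensional spaces *)

Section plane.
Context (R : realType) (V : normedModType R).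
Implicit Types u v w : V.

Lemma normr_lincomb2_ge u v (al be : R) : 0 <= be <= al -> `|v| <= 1 ->
  al * `|u + v| - (al - be) <= `|al *: u + be *: v|.
Proof.
move=> /andP[be0 ab] v1.
have -> : al *: u + be *: v = al *: (u + v) - (al - be) *: v.
  by rewrite scalerDr scalerBl opprB [RHS]addrC [_ + al *: v]addrC subrKA addrC.
apply: le_trans (lerB_dist _ _); rewrite !normrZ !ger0_norm; [|lra|lra].
by rewrite lerB// ler_piMr//; lra.
Qed.

Lemma ge_l1_of_sum_large u v (al be : R) : `|u| <= 1 -> `|v| <= 1 ->
  19 / 10 <= `|u + v| -> 0 <= al -> 0 <= be ->
  9 / 10 * (al + be) <= `|al *: u + be *: v|.
Proof.
move=> u1 v1 uv a0 b0; have [ba|ab] := leP be al.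
  have := @normr_lincomb2_ge u v al be; rewrite b0 ba => /(_ isT v1) h; nra.
have := @normr_lincomb2_ge v u be al; rewrite a0 ltW// => /(_ isT u1).
by rewrite (addrC v) (addrC (be *: v)) => h; nra.
Qed.

(** If [be <= al], the norm is at least [al / 5 + be] and at least [99 / 100 * al]; average these
    with weights 11/20 and 9/20. *)
Lemma ge_l1_of_sum_medium u v (al be : R) : `|u| <= 1 -> `|v| <= 1 ->
  6 / 5 <= `|u + v| -> 0 <= al -> 0 <= be ->
  99 / 100 * al <= `|al *: u + be *: v| -> 99 / 100 * be <= `|al *: u + be *: v| ->
  11 / 20 * (al + be) <= `|al *: u + be *: v|.
Proof.
move=> u1 v1 uv a0 b0 ha hb; have [ba|ab] := leP be al.
  have := @normr_lincomb2_ge u v al be; rewrite b0 ba => /(_ isT v1) h; nra.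
have := @normr_lincomb2_ge v u be al; rewrite a0 ltW// => /(_ isT u1).
by rewrite (addrC v) (addrC (be *: v)) => h; nra.
Qed.

Lemma lincomb2_comp u v (s t a b c d : R) :
  s *: (a *: u + b *: v) + t *: (c *: u + d *: v) =
  (s * a + t * c) *: u + (s * b + t * d) *: v.
Proof. by rewrite 2!scalerDr !scalerA addrACA [in RHS]scalerDl [in RHS]scalerDl. Qed.

(* The ratio 99/100 instead of 1 makes a near-maximiser of the determinant
   enough, so that no compactness is needed. *)
Definition almost_auerbach u v := [/\ `|u| <= 1, `|v| <= 1 &
  forall al be : R, 99 / 100 * `|al| <= `|al *: u + be *: v| /\
                    99 / 100 * `|be| <= `|al *: u + be *: v|].

(* By convexity the upper estimate need only be checked at the vertices
   [w1 + w2] and [w1 - w2] of the square. *)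
Definition linfty_basis w1 w2 := exists m M : R, [/\ 0 < m, M < 2 * m,
  `|w1 + w2| <= M, `|w1 - w2| <= M &
  forall s t : R, m * `|s| <= `|s *: w1 + t *: w2| /\
                  m * `|t| <= `|s *: w1 + t *: w2|].

Lemma almost_auerbachN u v : almost_auerbach u v -> almost_auerbach u (- v).
Proof.
move=> [u1 v1 uv]; split; rewrite ?normrN// => al be.
by have := uv al (- be); rewrite scalerN scaleNr normrN.
Qed.

Lemma sign_cases (P : R -> R -> Prop) :
  (forall al be, P (- al) (- be) -> P al be) ->
  (forall al be, 0 <= al -> 0 <= be -> P al be) ->
  (forall al be, 0 <= al -> 0 <= be -> P al (- be)) ->
  forall al be, P al be.
Proof.
move=> PN P1 P2 al be; have [a0|a0] := leP 0 al; have [b0|b0] := leP 0 be.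
- exact: P1.
- by rewrite -(opprK be); apply: P2 => //; rewrite oppr_ge0 ltW.
- by apply: PN; apply: P2 => //; rewrite oppr_ge0 ltW.
- by apply: PN; apply: P1; rewrite oppr_ge0 ltW.
Qed.

Lemma linfty_basis_of_sum_large u v : almost_auerbach u v ->
  19 / 10 <= `|u + v| ->
  exists a b c d : R, linfty_basis (a *: u + b *: v) (c *: u + d *: v).
Proof.
move=> [u1 v1 uv] uv2.
have large al be : 0 <= al -> 0 <= be -> _ := @ge_l1_of_sum_large u v al be u1 v1 uv2.
(* If [u - v] is not too short either, the norm is close enough to the [l_1]
   norm in [u, v]; otherwise the unit ball is almost the hexagon with vertices
   [u], [v], [u - v] and their opposites, at distance 3/2 from a parallelogram
   with one side parallel to [v]. *)
have [s2|s2] := leP (6 / 5) `|u - v|.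
  have l1 (al be : R) : 11 / 20 * (`|al| + `|be|) <= `|al *: u + be *: v|.
    move: al be; apply: sign_cases => [al be|al be a0 b0|al be a0 b0].
    - by rewrite !normrN !scaleNr -opprD normrN.
    - rewrite !ger0_norm//; apply: le_trans (large _ _ a0 b0); lra.
    - have [] := uv al (- be); rewrite normrN scaleNr -scalerN !ger0_norm// => h1 h2.
      by apply: ge_l1_of_sum_medium; rewrite ?normrN.
  (* The sum and difference of these two vectors are [u] and [v], so [M = 1]; the [l_1] estimate
     gives [m = 11 / 20]. *)
  exists (1 / 2), (1 / 2), (1 / 2), (- (1 / 2)), (11 / 20), 1.
  have e1 : 1 / 2 *: u + 1 / 2 *: v + (1 / 2 *: u + - (1 / 2) *: v) = u.
    by rewrite addrACA scaleNr subrr addr0 -scalerDl (_ : _ + _ = 1) ?scale1r//; lra.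
  have e2 : 1 / 2 *: u + 1 / 2 *: v - (1 / 2 *: u + - (1 / 2) *: v) = v.
    by rewrite opprD addrACA subrr add0r scaleNr opprK -scalerDl (_ : _ + _ = 1) ?scale1r//; lra.
  split; rewrite ?e1 ?e2//; try lra.
  move=> s t.
  have -> : s *: (1 / 2 *: u + 1 / 2 *: v) + t *: (1 / 2 *: u + - (1 / 2) *: v) =
      ((s + t) / 2) *: u + ((s - t) / 2) *: v.
    rewrite lincomb2_comp.
    by congr (_ *: _ + _ *: _); lra.
  have := l1 ((s + t) / 2) ((s - t) / 2).
  have h1 := ler_normD ((s + t) / 2) ((s - t) / 2).
  have h3 := ler_normB ((s + t) / 2) ((s - t) / 2).
  rewrite (_ : (s + t) / 2 + (s - t) / 2 = s) in h1; last lra.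
  rewrite (_ : (s + t) / 2 - (s - t) / 2 = t) in h3; last lra.
  by move=> h; split; lra.
(* With [w1 = u - v / 2] and [w2 = v], the vertex [w1 + w2 = u + v / 2] has norm at most 3/2, and
   [w1 - w2 = (u - v) - v / 2] at most 6/5 + 1/2. *)
exists 1, (- (1 / 2)), 0, 1, (89 / 100), (17 / 10).
rewrite scale0r add0r !scale1r; split; try lra.
- rewrite -addrA -{2}(scale1r v) -scalerDl (_ : - (1 / 2) + 1 = 1 / 2 :> R); last lra.
  apply: le_trans (ler_normD _ _) _; rewrite normrZ ger0_norm; lra.
- rewrite -addrA -{2}(scale1r v) -scalerBl (_ : - (1 / 2) - 1 = - 1 + - (1 / 2) :> R); last lra.
  rewrite scalerDl scaleN1r addrA.
  apply: le_trans (ler_normD _ _) _; rewrite normrZ normrN ger0_norm; lra.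
move=> s t.
have -> : s *: (u + - (1 / 2) *: v) + t *: v = s *: u + (t - s / 2) *: v.
  rewrite scalerDr scalerA -addrA -scalerDl; congr (_ + _ *: _); lra.
(* Here [al + 2 * be] is twice the [w2]-coordinate of [al *: u + be *: v]. *)
have key (al be : R) : 89 / 100 * `|al + 2 * be| <= 2 * `|al *: u + be *: v|.
  move: al be; apply: sign_cases => [al be|al be a0 b0|al be a0 b0].
  - by rewrite !scaleNr -opprD normrN mulrN -opprD normrN.
  - have := large _ _ a0 b0; have [_] := uv al be.
    rewrite !ger0_norm// => [h1 h2|]; lra.
  - have [] := uv al (- be); rewrite normrN !(@ger0_norm _ al, @ger0_norm _ be)// => h1 h2.
    by have [h|h] := leP 0 (al + 2 * - be); rewrite ?(ger0_norm h) ?(ltr0_norm h); lra.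
have [h1 _] := uv s (t - s / 2); have := key s (t - s / 2).
rewrite (_ : s + 2 * (t - s / 2) = 2 * t); last lra.
rewrite normrM (@ger0_norm _ 2)// => h2; split; have := normr_ge0 s; lra.
Qed.

(** Replacing [v] by [- v] exchanges [u + v] and [u - v]. If both are shorter than 19/10, then [u],
    [v] themselves will do, as 19/10 < 2 * 99/100. *)
Lemma exists_linfty_basis u v : almost_auerbach u v ->
  exists a b c d : R, linfty_basis (a *: u + b *: v) (c *: u + d *: v).
Proof.
move=> uv; have [r|r] := leP (19 / 10) `|u + v|.
  exact: linfty_basis_of_sum_large.
have [s|s] := leP (19 / 10) `|u - v|.
  have [a [b [c [d h]]]] := linfty_basis_of_sum_large (almost_auerbachN uv) s.
  by exists a, (- b), c, (- d); rewrite !scaleNr -!scalerN.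
have [_ _ h] := uv.
exists 1, 0, 0, 1, (99 / 100), (19 / 10).
by rewrite !scale0r !scale1r addr0 add0r; split=> //; try lra.
Qed.

(** Auerbach's argument in coordinates: if [det p q] is at least [99 / 100] of its supremum [D] over
    the unit ball and [z = al p + be q], then [det z q = al * det p q] is at most [D * nu z], and
    likewise for [be]. The hypothesis makes [D] finite. *)
Lemma exists_almost_auerbach (x y : V) (L : R) :
  (forall s t : R, `|s| <= L * `|s *: x + t *: y| /\ `|t| <= L * `|s *: x + t *: y|) ->
  exists a b c d : R, almost_auerbach (a *: x + b *: y) (c *: x + d *: y).
Proof.
move=> Lxy.
have L0 : 0 < L.
  have [h _] := Lxy 1 0; rewrite normr1 in h.
  by rewrite ltNge; apply/negP => L0; have := normr_ge0 (1 *: x + 0 *: y); nra.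
pose nu (p : R * R) := `|p.1 *: x + p.2 *: y|.
have nu0 p : 0 <= nu p by exact: normr_ge0.
pose det (p q : R * R) := p.1 * q.2 - p.2 * q.1.
pose S := [set det p q | p in [set p | nu p <= 1] & q in [set q | nu q <= 1]].
have Sub : ubound S (2 * L ^+ 2).
  move=> _ [p /= p1] [q /= q1] <-.
  have [h1 h2] := Lxy p.1 p.2; have [h3 h4] := Lxy q.1 q.2.
  have : `|p.1| <= L by apply: le_trans h1 _; rewrite ler_piMr// ltW.
  have : `|p.2| <= L by apply: le_trans h2 _; rewrite ler_piMr// ltW.
  have : `|q.1| <= L by apply: le_trans h3 _; rewrite ler_piMr// ltW.
  have : `|q.2| <= L by apply: le_trans h4 _; rewrite ler_piMr// ltW.
  rewrite /det !ler_norml => /andP[? ?] /andP[? ?] /andP[? ?] /andP[? ?]; nra.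
pose D := sup S.
have detD p q : nu p <= 1 -> nu q <= 1 -> det p q <= D.
  by move=> p1 q1; apply: ub_le_sup; [exists (2 * L ^+ 2)|exists p => //; exists q].
have nuZ (r : R) p : nu (r * p.1, r * p.2) = `|r| * nu p.
  by rewrite /nu -normrZ scalerDr !scalerA.
have nu_eq0 p : nu p = 0 -> p.1 = 0 /\ p.2 = 0.
  move=> p0; have [] := Lxy p.1 p.2; rewrite -/(nu p) p0 mulr0 !normr_le0.
  by move=> /eqP -> /eqP ->.
have nuinv p : nu p != 0 -> nu ((nu p)^-1 * p.1, (nu p)^-1 * p.2) <= 1.
  by move=> p0; rewrite nuZ normfV ger0_norm// mulVf.
have D0 : 0 < D.
  pose p : R * R := (1, 0); pose q : R * R := (0, 1).
  have p0 : nu p != 0 by apply/eqP => /nu_eq0/= [/eqP]; rewrite oner_eq0.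
  have q0 : nu q != 0 by apply/eqP => /nu_eq0/= [_ /eqP]; rewrite oner_eq0.
  apply: lt_le_trans (detD _ _ (nuinv _ p0) (nuinv _ q0)).
  by rewrite /det /= !mulr0 !mulr1 subr0 mulr_gt0// invr_gt0 lt_neqAle eq_sym ?p0 ?q0 nu0.
have det_le p q : nu q <= 1 -> det p q <= D * nu p.
  move=> q1; have [p0|p0] := eqVneq (nu p) 0.
    by have [h1 h2] := nu_eq0 _ p0; rewrite /det h1 h2 p0 !mul0r subr0 mulr0.
  have := detD _ _ (nuinv _ p0) q1; rewrite /det /= -!mulrA -mulrBr.
  by rewrite ler_pdivrMl ?(mulrC D)// lt_neqAle eq_sym p0 nu0.
have Ssup : has_sup S.
  split; last by exists (2 * L ^+ 2).
  have h : nu (0, 0) <= 1 by rewrite /nu !scale0r addr0 normr0.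
  by exists (det (0, 0) (0, 0)); exists (0, 0) => //; exists (0, 0).
have e0 : 0 < D / 100 by rewrite divr_gt0.
have [_ [p /= p1] [q /= q1] <- lt] := sup_adherent e0 Ssup.
exists p.1, p.2, q.1, q.2; split=> // al be.
pose z := (al * p.1 + be * q.1, al * p.2 + be * q.2).
have -> : al *: (p.1 *: x + p.2 *: y) + be *: (q.1 *: x + q.2 *: y) = z.1 *: x + z.2 *: y.
  exact: lincomb2_comp.
rewrite -/(nu z).
have nuN (w : R * R) : nu (- w.1, - w.2) = nu w by rewrite /nu !scaleNr -opprD normrN.
have h1 := det_le z q q1.
have h2 := det_le (- z.1, - z.2) q q1.
have h3 := det_le z p p1.
have h4 := det_le (- z.1, - z.2) p p1.
rewrite nuN in h2 h4.
have e1 : det z q = al * det p q by rewrite /det /=; ring.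
have e2 : det (- z.1, - z.2) q = - (al * det p q) by rewrite /det /=; ring.
have e3 : det z p = - (be * det p q) by rewrite /det /=; ring.
have e4 : det (- z.1, - z.2) p = be * det p q by rewrite /det /=; ring.
rewrite e1 in h1; rewrite e2 in h2; rewrite e3 in h3; rewrite e4 in h4.
have dp : 99 / 100 * D <= det p q by apply: ltW; rewrite -/D in lt; lra.
have absl (r : R) : r * det p q <= D * nu z -> - (r * det p q) <= D * nu z ->
    99 / 100 * `|r| <= nu z.
  move=> hr1 hr2; rewrite -(ler_pM2l D0).
  have : `|r| * det p q <= D * nu z.
    rewrite -[det p q]gtr0_norm ?(lt_le_trans _ dp) ?mulr_gt0 ?divr_gt0// -normrM.
    by rewrite ler_norml hr1 andbT lerNl.
  by have := normr_ge0 r; nra.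
by split; apply: absl.
Qed.

Lemma normrD_le_max (s t : R) : `|s| + `|t| <= Num.max `|s + t| `|s - t|.
Proof.
rewrite le_max !ler_normr; have [s0|s0] := leP 0 s; have [t0|t0] := leP 0 t;
  rewrite ?(ger0_norm s0) ?(ger0_norm t0) ?(ltr0_norm s0) ?(ltr0_norm t0).
- by rewrite lexx.
- by rewrite lexx !orbT.
- by rewrite opprB (addrC t) lexx !orbT.
- by rewrite opprD lexx !orbT.
Qed.

Lemma plane_linfty_copy (x y : V) (L : R) :
  (forall s t : R, `|s| <= L * `|s *: x + t *: y| /\ `|t| <= L * `|s *: x + t *: y|) ->
  exists (h : 'I_2 -> V) (m M : R), [/\ 0 < m, M < 2 * m,
    forall i, exists a b : R, h i = a *: x + b *: y &
    forall a : 'rV_2, m * `|a| <= `|lincomb h a| <= M * `|a|].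
Proof.
move=> /exists_almost_auerbach [a [b [c [d /exists_linfty_basis]]]].
set u := a *: x + _; set v := c *: x + _.
move=> [a' [b' [c' [d' [m [M [m0 Mm]]]]]]].
set w1 := a' *: u + _; set w2 := c' *: u + _ => wM1 wM2 wm.
have comb (s t : R) : exists a b : R, s *: u + t *: v = a *: x + b *: y.
  exists (s * a + t * c), (s * b + t * d).
  exact: lincomb2_comp.
exists (fun i => if i == ord0 then w1 else w2), m, M; split=> //.
  by move=> i; case: ifP => _; exact: comb.
clearbody w1 w2.
move=> A; rewrite /lincomb big_ord_recl big_ord1 /=.
set s := A 0 _; set t := A 0 _; have [h1 h2] := wm s t.
have Ast : `|A| = Num.max `|s| `|t|.
  apply/eqP; rewrite eq_le; apply/andP; split.
    rewrite [leLHS]/Num.norm/= mx_normrE; apply/bigmax_leP.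
    split=> [|[i j] _ /=]; first by rewrite le_max normr_ge0.
    rewrite ord1; have [->|j0] := eqVneq j ord0; first by rewrite le_max lexx.
    rewrite (_ : j = lift ord0 ord0) ?le_max ?lexx ?orbT//.
    by apply/val_inj => /=; case: j j0 => -[|[|]].
  rewrite ge_max; apply/andP; split; rewrite [leRHS]/Num.norm/= mx_normrE;
    apply/bigmax_geP; right => /=.
    by exists (0, ord0).
  by exists (0, lift ord0 ord0).
rewrite Ast; apply/andP; split; first by case: (leP `|s| `|t|).
(* Written in terms of the two vertices, the coefficients have absolute values summing to at most
   [Num.max |s| |t|]. *)
have -> : s *: w1 + t *: w2 = ((s + t) / 2) *: (w1 + w2) + ((s - t) / 2) *: (w1 - w2).
  rewrite !scalerDr scalerN addrACA -scalerDl -scalerBl.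
  by congr (_ *: _ + _ *: _); lra.
have M0 : 0 <= M by apply: le_trans wM1.
apply: le_trans (ler_normD _ _) _.
rewrite (normrZ _ (w1 + w2)) (normrZ _ (w1 - w2)).
apply: (@le_trans _ _ (`|(s + t) / 2| * M + `|(s - t) / 2| * M)).
  by apply: lerD; rewrite ler_wpM2l.
rewrite -mulrDl mulrC ler_wpM2l//.
rewrite [X in Num.max `|X| _](_ : s = (s + t) / 2 + (s - t) / 2); last lra.
rewrite [X in Num.max _ `|X|](_ : t = (s + t) / 2 - (s - t) / 2); last lra.
exact: normrD_le_max.
Qed.

End plane.

(** * Normalised copies of Hilbert space *)

Section hilbert_copy.
Context (R : realType).

Lemma l2normE n (x : l2 R n) : `|x| = Num.sqrt (\sum_(i < n) x 0 i ^+ 2).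
Proof. by []. Qed.

Lemma normr_coord_le_l2 n (x : l2 R n) i : `|x 0 i| <= `|x|.
Proof.
rewrite l2normE -sqrtr_sqr ler_sqrt ?sumr_ge0//; last by move=> *; exact: sqr_ge0.
by rewrite (bigD1 i)//= lerDl sumr_ge0// => *; exact: sqr_ge0.
Qed.

Lemma l2_sqr n (x : l2 R n) : `|x| ^+ 2 = \sum_(i < n) x 0 i ^+ 2.
Proof. by rewrite l2normE sqr_sqrtr// sumr_ge0// => *; exact: sqr_ge0. Qed.

(** Excludes the value 0, so that a product of two such norms is never of the form 0 times
    infinity. *)
Lemma opnorm_fin_gt0 (V W : normedModType R) (f : {linear V -> W}) (x : V) :
  f x != 0 -> opnorm f = +oo%E \/ exists2 M : R, 0 < M & opnorm f = M%:E.
Proof.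
move=> fx; case E : (opnorm f) => [M| |]; [right|by left|].
  exists M => //; rewrite ltNge; apply/negP => M0.
  have := @opnormP _ _ _ f M x; rewrite E lexx => /(_ isT) h.
  have : `|f x| <= 0 by apply: le_trans h _; rewrite mulr_le0_ge0.
  by rewrite normr_le0 (negbTE fx).
by have := opnorm_ge0 f; rewrite E.
Qed.

(** The infimum defining the distance need not be attained, so a pair [T], [T'] with norm product
    below [2 * a] is used, and [S] is [T'] divided by its norm. That [a < 2 * a] follows from
    [1 <= a], since [T] inverts [T']. *)
Lemma hilbert_copy (V : normedModType R) (E : submodClosed V) (n : nat) (a : R) :
  (0 < n)%N -> banach_mazur (subsp E) (l2 R n) = a%:E ->
  0 < a /\ exists S : {linear l2 R n -> V},
    [/\ forall t, S t \in E, forall t, `|S t| <= `|t| &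
        forall t, `|t| <= 2 * a * `|S t|].
Proof.
move=> n0 aE.
pose e : l2 R n := \row_i 1.
have e0 : e != 0.
  by apply/eqP => /rowP/(_ (Ordinal n0)); rewrite !mxE => /eqP; rewrite oner_eq0.
have bounds (T : {linear subsp E -> l2 R n}) (T' : {linear l2 R n -> subsp E}) :
    cancel T' T ->
    (opnorm T * opnorm T' = +oo)%E \/ exists M M' : R,
      [/\ 0 < M, 0 < M', opnorm T = M%:E, opnorm T' = M'%:E & 1 <= M * M'].
  move=> T'K.
  have T'e : T' e != 0.
    by apply: contra e0 => /eqP T'e; rewrite -(T'K e) T'e linear0.
  have TT'e : T (T' e) != 0 by rewrite T'K.
  have [oT|[M M0 oT]] := opnorm_fin_gt0 TT'e; have [oT'|[M' M'0 oT']] := opnorm_fin_gt0 T'e.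
  - by left; rewrite oT oT' mulyy.
  - by left; rewrite oT oT' gt0_mulye// lte_fin.
  - by left; rewrite oT oT' gt0_muley// lte_fin.
  right; exists M, M'; split=> //.
  have h1 := @opnormP _ _ _ T M (T' e); have h2 := @opnormP _ _ _ T' M' e.
  rewrite oT lexx in h1; rewrite oT' lexx in h2.
  have := le_trans (h1 isT) (ler_wpM2l (ltW M0) (h2 isT)).
  by rewrite T'K mulrA ler_pMl ?normr_gt0.
have a1 : 1 <= a.
  rewrite -lee_fin -aE; apply: le_ereal_inf_tmp => _ [T [T' [_ _ _ T'K ->]]].
  have [->|[M [M' [_ _ -> -> h]]]] := bounds _ _ T'K; first by rewrite leey.
  by rewrite -EFinM lee_fin.
have a0 : 0 < a by apply: lt_le_trans a1.
split=> //.
have : (banach_mazur (subsp E) (l2 R n) < (2 * a)%:E)%E by rewrite aE lte_fin; lra.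
move=> /ereal_inf_lt[_ [T [T' [_ _ _ T'K ->]]]].
have [->//|[M [M' [M0 M'0 oT oT' _]]]] := bounds _ _ T'K.
rewrite oT oT' -EFinM lte_fin => MM'.
pose S (t : l2 R n) : V := M'^-1 *: val (T' t).
have linS : linear S.
  by move=> r x y; rewrite /S linearP /= scalerDr !scalerA mulrC.
pose SL : {linear l2 R n -> V} := HB.pack S (GRing.isLinear.Build R _ _ _ S linS).
exists SL; split=> t.
- by rewrite /= rpredZ// subspP.
- rewrite /= normrZ gtr0_norm ?invr_gt0// ler_pdivrMl//.
  by apply: (@opnormP _ _ _ T' M' t); rewrite oT'.
have := @opnormP _ _ _ T M (T' t); rewrite oT lexx T'K => /(_ isT) h.
rewrite /= normrZ gtr0_norm ?invr_gt0// mulrA.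
apply: le_trans h _; rewrite ler_wpM2r//.
by rewrite ler_pdivlMr// ltW.
Qed.

(** Expanding the square, each diagonal term is at most 1 and each off-diagonal one at most [d]. *)
Lemma l2_sum_le n N (t : 'I_N -> l2 R n) (A : {set 'I_N}) (e : 'I_N -> R) (d : R) :
  0 <= d -> (forall i, `|e i| <= 1) -> (forall i, `|t i| = 1) ->
  (forall i j, i != j -> `|\sum_k t i 0 k * t j 0 k| <= d) ->
  `|\sum_(i in A) e i *: t i| ^+ 2 <= #|A|%:R + #|A|%:R ^+ 2 * d.
Proof.
move=> d0 e1 t1 td; rewrite l2_sqr.
have -> : \sum_k (\sum_(i in A) e i *: t i : 'rV_n) 0 k ^+ 2 =
    \sum_(i in A) \sum_(j in A) e i * e j * \sum_k t i 0 k * t j 0 k.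
  under [LHS]eq_bigr => k _.
    rewrite summxE expr2 mulr_suml.
    under eq_bigr do rewrite mulr_sumr.
    over.
  rewrite exchange_big; apply: eq_bigr => i _ /=.
  rewrite exchange_big; apply: eq_bigr => j _ /=.
  by rewrite mulr_sumr; apply: eq_bigr => k _; rewrite !mxE; ring.
apply: (@le_trans _ _ (\sum_(i in A) (1 + #|A|%:R * d))); last first.
  by rewrite sumr_const -[leLHS]mulr_natl mulrDr mulr1 mulrA expr2.
apply: ler_sum => i iA; rewrite (bigD1 i)//= lerD//.
  have -> : \sum_k t i 0 k * t i 0 k = 1.
    by rewrite -[RHS](expr1n _ 2) -(t1 i) l2_sqr; apply: eq_bigr => k _; rewrite expr2.
  by rewrite mulr1 -expr2 -real_normK ?num_real// expr_le1.
apply: (@le_trans _ _ (\sum_(j in A) d)); last by rewrite sumr_const mulr_natl.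
rewrite [leRHS](bigD1 i)//= -[leLHS]add0r lerD//.
apply: ler_sum => j /andP[_ ji]; apply: le_trans (ler_norm _) _.
rewrite !normrM; apply: le_trans (td i j _); last by rewrite eq_sym.
by rewrite ler_piMl// mulr_ile1.
Qed.

End hilbert_copy.

(** * Large copies of [l_infty^j] from almost orthonormal systems *)

Section linfty_in_range.
Context (R : realType) (K : topologicalType) (cptK : compact [set: K]).
Local Notation C := (contfun R cptK).
Context (X : normedModType R) (U : {linear C -> X}).
Hypothesis U1 : forall f, `|U f| <= `|f|.
Context (n : nat) (S : {linear l2 R n -> C}) (c : R).
Hypothesis c01 : 0 < c <= 1.
Hypothesis S1 : forall t, `|S t| <= `|t|.
Hypothesis US : forall t, c * `|t| <= `|U (S t)|.

(** Let [s] count the indices where [|S (t i) x| > c / 2]. With suitable signs the sum [P] of these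
    values is the value at [x] of [S] on a signed sum of [s] of the [t i], so [P^2 <= s + s^2 c^2 /
    4 <= (1 / c + s c / 2)^2]. *)
Lemma sum_excess_le N (t : 'I_N -> l2 R n) x :
  (forall i, `|t i| = 1) ->
  (forall i j, i != j -> `|\sum_k t i 0 k * t j 0 k| <= c ^+ 2 / 4) ->
  \sum_i Num.max (`|S (t i) x| - c / 2) 0 <= c^-1.
Proof.
move=> t1 td; have /andP[c0 c1] := c01.
pose A := [set i | c / 2 < `|S (t i) x|]%SET.
pose e i : R := Num.sg (S (t i) x).
have e1 i : `|e i| <= 1 by rewrite normr_sg; case: (_ != _).
pose P := \sum_(i in A) `|S (t i) x|.
have -> : \sum_i Num.max (`|S (t i) x| - c / 2) 0 = P - #|A|%:R * (c / 2).
  rewrite (bigID (mem A)) /= [X in _ + X]big1 ?addr0.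
    rewrite mulr_natl -sumr_const -sumrB; apply: eq_bigr => i.
    by rewrite inE => iA; rewrite max_l// subr_ge0 ltW.
  by move=> i; rewrite inE -leNgt => iA; rewrite max_r// subr_le0.
have P0 : 0 <= P by apply: sumr_ge0.
have PS : P <= `|\sum_(i in A) e i *: t i|.
  apply: le_trans (S1 _); apply: le_trans (normr_contfun_le _ x).
  rewrite linear_sum contfun_sum; apply: le_trans (ler_norm _).
  rewrite le_eqVlt; apply/orP; left; apply/eqP; apply: eq_bigr => i _.
  by rewrite linearZ contfunZ /e -normrEsg.
have d0 : 0 <= c ^+ 2 / 4 by rewrite divr_ge0 ?sqr_ge0.
have := l2_sum_le A d0 e1 t1 td.
have := ler_pM P0 P0 PS PS; rewrite -!expr2 => /le_trans h /h{h}.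
set s : R := #|A|%:R => Ps.
have s0 : 0 <= s by [].
rewrite lerBlDr -ler_sqr ?nnegrE//; last by rewrite addr_ge0 ?invr_ge0 ?mulr_ge0 ?divr_ge0// ltW.
apply: le_trans Ps _.
have -> : (c^-1 + s * (c / 2)) ^+ 2 = c^-1 ^+ 2 + s + s ^+ 2 * (c ^+ 2 / 4).
  by field; rewrite gt_eqF.
by rewrite lerD2r lerDr sqr_ge0.
Qed.

Lemma linfty_of_almost_orthonormal N (t : nat -> l2 R n) :
  (forall i : 'I_N, `|t i| = 1) ->
  (forall i j : 'I_N, i != j -> `|\sum_k t i 0 k * t j 0 k| <= c ^+ 2 / 4) ->
  exists (j : nat) (h : 'I_j -> C), N%:R * c ^+ 2 <= 34 * j%:R /\
    forall a : 'rV_j, `|lincomb h a| = `|a| /\ c / 4 * `|a| <= `|U (lincomb h a)|.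
Proof.
move=> t1 td; have /andP[c0 c1] := c01.
have c20 : 0 < c ^+ 2 by rewrite exprn_gt0.
have c21 : c ^+ 2 <= 1 by rewrite expr_le1// ltW.
(* As [r + 1 > 16 / c^2], the row bound [2 / (c (r + 1))] is at most [c / 8]; as [r <= 16 / c^2],
   one has [(r + 1) c^2 <= 17], whence 34 = 2 * 17. *)
pose r := Num.truncn (16 / c ^+ 2).
have r16 : 0 <= 16 / c ^+ 2 by rewrite divr_ge0// ltW.
have /andP[r1 r2] := truncn_itv r16; rewrite -/r in r1 r2.
have [|||||I [h [NI disj h1 hU]]] :=
  @disjoint_bumps _ _ _ _ U U1 N r (fun i => S (t i)) c c^-1 c0.
- by rewrite invr_gt0.
- rewrite ler_pdivrMr//; rewrite ltr_pdivrMr// in r2.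
  rewrite -(ler_pM2l c0) mulrCA divff ?gt_eqF//.
  rewrite expr2 in r2; nra.
- by move=> i; apply: le_trans (US _); rewrite t1 mulr1.
- by move=> i; apply: le_trans (S1 _) _; rewrite t1.
- by move=> x; exact: (@sum_excess_le N (fun i => t i)).
have c4 : 0 < c / 4 by rewrite divr_gt0.
have [h' h'P] := linfty_copy U1 c4 disj h1 hU.
exists #|I|, h'; split=> //.
have : N%:R <= (2 * r.+1 * #|I|)%:R :> R by rewrite ler_nat.
rewrite !natrM => hN.
rewrite ler_pdivlMr// in r1.
have rc : r.+1%:R * c ^+ 2 <= 17 by rewrite -natr1 mulrDl mul1r; lra.
apply: le_trans (ler_wpM2r (ltW c20) hN) _.
have := ler_wpM2r (ler0n R #|I|) rc; nra.
Qed.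

Lemma linfty_of_orthonormal_basis :
  exists (j : nat) (h : 'I_j -> C), n%:R * c ^+ 2 <= 34 * j%:R /\
    forall a : 'rV_j, `|lincomb h a| = `|a| /\ c / 4 * `|a| <= `|U (lincomb h a)|.
Proof.
pose t (i : nat) : l2 R n := \row_k (i == k)%:R.
apply: (@linfty_of_almost_orthonormal n t) => [i|i j ij].
  rewrite l2normE (bigD1 i)//= big1 ?addr0 => [|k ki].
    by rewrite mxE eqxx expr1n sqrtr1.
  by rewrite mxE val_eqE eq_sym (negbTE ki) expr0n.
rewrite big1 ?normr0 ?divr_ge0 ?sqr_ge0// => k _; rewrite !mxE !val_eqE.
have [<-|_] := eqVneq i k; last by rewrite mul0r.
by rewrite eq_sym (negbTE ij) mulr0.
Qed.

Lemma linfty_of_signs : (0 < n)%N ->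
  exists (j : nat) (h : 'I_j -> C),
    expR (c ^+ 4 * n%:R / 128) / 2 * c ^+ 2 <= 34 * j%:R /\
    forall a : 'rV_j, `|lincomb h a| = `|a| /\ c / 4 * `|a| <= `|U (lincomb h a)|.
Proof.
move=> n0; have /andP[c0 c1] := c01.
have c21 : c ^+ 2 <= 1 by rewrite expr_le1// ltW.
(* With [l = c^2 / 4] the exponent [l^2 n / 8] becomes [c^4 n / 128]. *)
have l01 : 0 < c ^+ 2 / 4 <= 1 by rewrite divr_gt0 ?exprn_gt0//=; lra.
have [A [cardA corr]] := many_uncorrelated_signs n l01.
have nR : 0 < n%:R :> R by rewrite ltr0n.
pose d0 : {ffun 'I_n -> bool} := [ffun=> false].
pose t (i : nat) : l2 R n :=
  \row_k ((Num.sqrt n%:R)^-1 * (-1) ^+ (nth d0 (enum A) i k)).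
have [||j [h [Nj hP]]] := @linfty_of_almost_orthonormal #|A| t.
- move=> i; rewrite l2normE (eq_bigr (fun=> n%:R^-1)) => [|k _].
    by rewrite sumr_const card_ord -[_ *+ n]mulr_natr mulVf ?gt_eqF// sqrtr1.
  by rewrite mxE exprMn exprVn sqr_sqrtr// sqrr_sign mulr1.
- move=> i j ij.
  rewrite (eq_bigr (fun k => n%:R^-1 * ((-1) ^+ (nth d0 (enum A) i k) *
    (-1) ^+ (nth d0 (enum A) j k)))) => [|k _]; last first.
    by rewrite !mxE mulrACA -expr2 exprVn sqr_sqrtr.
  rewrite -mulr_sumr normrM gtr0_norm ?invr_gt0// ler_pdivrMl// mulrC.
  have iA (k : 'I_#|A|) : nth d0 (enum A) k \in A.
    by rewrite -mem_enum mem_nth// -cardE.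
  apply: corr => //; rewrite nth_uniq ?enum_uniq// -cardE; exact: ltn_ord.
exists j, h; split=> //; apply: le_trans Nj.
rewrite ler_wpM2r ?sqr_ge0//; apply: le_trans cardA.
by rewrite le_eqVlt; apply/orP; left; apply/eqP; congr (expR _ / _); field.
Qed.

End linfty_in_range.

(** * The case [j = 2] *)

Section two_dimensional_copy.
Context (R : realType) (V X : normedModType R) (U : {linear V -> X}).
Context (n : nat) (S : {linear l2 R n -> V}) (c L : R).
Hypothesis c0 : 0 < c.
Hypothesis S1 : forall t, `|S t| <= `|t|.
Hypothesis SL : forall t, `|t| <= L * `|S t|.
Hypothesis US : forall t, c * `|t| <= `|U (S t)|.

(** Works in the image under [S] of the plane of the first two unit vectors: coordinates are bounded
    by the Euclidean norm, so [SL] makes their images quantitatively independent. *)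
Lemma two_dimensional_linfty_copy : (2 <= n)%N ->
  exists (h : 'I_2 -> V) (m M : R), [/\ 0 < m, M < 2 * m,
    forall a : 'rV_2, m * `|a| <= `|lincomb h a| <= M * `|a| &
    forall a : 'rV_2, c * `|lincomb h a| <= `|U (lincomb h a)|].
Proof.
move=> n2; have n1 : (0 < n)%N by apply: ltn_trans n2.
pose i1 := Ordinal n1; pose i2 := Ordinal n2.
pose e (i : 'I_n) : l2 R n := \row_k (k == i)%:R.
have [s t|h [m [M [m0 Mm hS hmM]]]] := @plane_linfty_copy _ _ (S (e i1)) (S (e i2)) L.
  rewrite -!linearZ -linearD.
  set z := _ + _; have z1 : z 0 i1 = s by rewrite !mxE eqxx /= mulr1 mulr0 addr0.
  have z2 : z 0 i2 = t by rewrite !mxE eqxx /= mulr1 mulr0 add0r.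
  by split; apply: le_trans (SL z); [rewrite -z1|rewrite -z2]; exact: normr_coord_le_l2.
exists h, m, M; split=> // a.
have [z ->] : exists z, lincomb h a = S z.
  have [z zP] : {z : 'I_2 -> l2 R n & forall i, h i = S (z i)}.
    apply: (choice (P := fun i (t : l2 R n) => h i = S t)) => i; have [p [q ->]] := hS i.
    by exists (p *: e i1 + q *: e i2); rewrite linearD !linearZ.
  exists (\sum_i a 0 i *: z i); rewrite linear_sum; apply: eq_bigr => i _.
  by rewrite zP linearZ.
by apply: le_trans (US z); rewrite ler_wpM2l// ltW.
Qed.

End two_dimensional_copy.

(** * Numerical estimates for the constants *)

Section numerical_bounds.
Context (R : realType).

Lemma powR_expR (x y : R) : expR x `^ y = expR (x * y).
Proof. by rewrite /powR gt_eqF ?expR_gt0// expRK mulrC. Qed.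

(** With [x = 1 / q], one has [8 x <= 1 + 32 x^2 <= exp (32 x^2)]. *)
Lemma expR32_powR_le (q : R) : 0 < q -> expR 32 `^ (- (q^-1 ^+ 2)) <= q / 8.
Proof.
move=> q0; rewrite powR_expR mulrN expRN -[leRHS]invrK lef_pV2 ?posrE ?expR_gt0//; last first.
  by rewrite invr_gt0 divr_gt0.
apply: le_trans (expR_ge1Dx _); rewrite invf_div.
by have := sqr_ge0 (q^-1 - 1 / 8); rewrite -/(q^-1); set x := q^-1; nra.
Qed.

Lemma expR_half_le2 : expR (1 / 2) <= 2 :> R.
Proof.
rewrite -[X in expR X]opprK expRN -[leRHS]invrK lef_pV2 ?posrE ?expR_gt0//.
by apply: le_trans (expR_ge1Dx _); lra.
Qed.

(** Multiplying the two hypotheses cancels the powers of [c]: for [y = c^4 n] they give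
    [exp (y / 128) * y / 2 <= 34^2 j1 j2], and [y >= 2 * 34^2] absorbs the constant. *)
Lemma max_family_size (c : R) (n : nat) (j1 j2 : R) : 0 < c -> 0 <= j1 -> 0 <= j2 ->
  2 * 34 * 34 <= c ^+ 4 * n%:R ->
  expR (c ^+ 4 * n%:R / 128) / 2 * c ^+ 2 <= 34 * j1 -> n%:R * c ^+ 2 <= 34 * j2 ->
  expR (c ^+ 4 * n%:R / 256) <= j1 \/ expR (c ^+ 4 * n%:R / 256) <= j2.
Proof.
move=> c0 j10 j20 big h1 h2; apply/orP; rewrite -[_ || _]negbK negb_or -!ltNge.
apply/negP => /andP[l1 l2].
set y := c ^+ 4 * n%:R in big h1 l1 l2.
have lt12 : j1 * j2 < expR (y / 128).
  rewrite (_ : y / 128 = y / 256 + y / 256); last by field.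
  by rewrite expRD; exact: ltr_pM.
have p1 : 0 <= expR (y / 128) / 2 * c ^+ 2.
  by rewrite mulr_ge0 ?divr_ge0 ?expR_ge0 ?sqr_ge0.
have p2 : 0 <= n%:R * c ^+ 2 :> R by rewrite mulr_ge0 ?sqr_ge0.
have := ler_pM p1 p2 h1 h2.
have -> : expR (y / 128) / 2 * c ^+ 2 * (n%:R * c ^+ 2) = expR (y / 128) * y / 2.
  by rewrite /y; field.
by have := expR_gt0 (y / 128); nra.
Qed.

End numerical_bounds.

Theorem corollary20 (R : realType) :
  exists A1 A2 : R, [/\ 1 < A1, 1 < A2 &
  forall (K : topologicalType) (cptK : compact [set: K]),
  hausdorff_space K ->
  forall (X : completeNormedModType R) (U : {linear contfun R cptK -> X}),
  opnorm U = 1%:E ->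
  forall (n : nat) (E : submodClosed (contfun R cptK)) (a b : R),
  (2 <= n)%N ->
  banach_mazur (subsp E) (l2 R n) = a%:E ->
  0 < b ->
  (forall x, x \in E -> b * `|x| <= `|U x|) ->
  exists (G : submodClosed (contfun R cptK)) (j : nat),
    [/\ A2 `^ ((b / a) ^+ 4 * n%:R) <= j%:R,
        (banach_mazur (subsp G) (linfty R j) < 2%:E)%E &
        forall x, x \in G -> A1 `^ (- ((a / b) ^+ 2)) * `|x| <= `|U x|]].
Proof.
(* Since [c = b / (2 a)], the exponent [(b / a)^4 n] equals [16 y] with [y = c^4 n]. As 272 * 272 =
   16 * 2 * (2 * 34 * 34), the required [j] is at least [exp (y / 4624)], which stays below
   [exp (1 / 2) <= 2] until [y] reaches the threshold 2 * 34 * 34. *)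
exists (expR 32), (expR ((272 * 272)^-1)).
split; [by rewrite -expR0 ltr_expR|by rewrite -expR0 ltr_expR invr_gt0|].
move=> K cptK _ X U U1 n E a b n2 aE b0 UE.
have Ule f : `|U f| <= `|f|.
  by have := @opnormP _ _ _ U 1 f; rewrite U1 lexx mul1r; apply.
have [a0 [S [SE S1 SL]]] := hilbert_copy (ltn_trans (ltnSn 0) n2) aE.
pose c := b / (2 * a).
have c0 : 0 < c by rewrite divr_gt0// mulr_gt0.
have US t : c * `|t| <= `|U (S t)|.
  apply: le_trans (UE _ (SE t)); rewrite /c -mulrA ler_pM2l//.
  by rewrite ler_pdivrMl ?mulr_gt0.
have q0 : 0 < b / a by rewrite divr_gt0.
have cq : c = b / a / 2 by rewrite /c; field; rewrite gt_eqF.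
have c1 : c <= 1.
  pose e : l2 R n := \row_i 1.
  have e0 : 0 < `|e|.
    rewrite normr_gt0; apply/eqP => /rowP/(_ (Ordinal n2)).
    by rewrite !mxE => /eqP; rewrite oner_eq0.
  rewrite -(ler_pM2r e0) mul1r.
  by apply: le_trans (US e) _; apply: le_trans (Ule _) _; exact: S1.
have c01 : 0 < c <= 1 by rewrite c0.
have A1c : expR 32 `^ (- ((a / b) ^+ 2)) <= c / 4.
  by rewrite -[a / b]invf_div; apply: le_trans (expR32_powR_le q0) _; rewrite cq; lra.
have yc : (b / a) ^+ 4 * n%:R = 16 * (c ^+ 4 * n%:R) by rewrite cq; field; rewrite gt_eqF.
rewrite powR_expR yc; set y := c ^+ 4 * n%:R.
have finish j (h : 'I_j -> contfun R cptK) (m M : R) : 0 < m -> M < 2 * m ->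
    (forall a, m * `|a| <= `|lincomb h a| <= M * `|a|) ->
    (forall a, c / 4 * `|lincomb h a| <= `|U (lincomb h a)|) ->
    expR ((272 * 272)^-1 * (16 * y)) <= j%:R ->
    exists (G : submodClosed (contfun R cptK)) (j : nat),
    [/\ expR ((272 * 272)^-1 * (16 * y)) <= j%:R,
        (banach_mazur (subsp G) (linfty R j) < 2%:E)%E &
        forall x, x \in G -> expR 32 `^ (- ((a / b) ^+ 2)) * `|x| <= `|U x|].
  move=> m0 Mm hmM hU jle; exists (span h), j; split=> //.
    exact: banach_mazur_span m0 Mm hmM.
  by move=> x /spanP[t ->]; apply: le_trans (hU t); rewrite ler_wpM2r.
(* Below the threshold a plane suffices; above it, the larger of the two families has size at least
   [exp (y / 256)]. *)
have [ybig|ysmall] := leP (2 * 34 * 34) y; last first.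
  have [h [m [M [m0 Mm hmM hU]]]] := two_dimensional_linfty_copy c0 S1 SL US n2.
  apply: finish m0 Mm hmM _ _ => [t|].
    by apply: le_trans (hU t); rewrite ler_wpM2r//; lra.
  by apply: le_trans (expR_half_le2 R); rewrite ler_expR; lra.
have isometric j (h : 'I_j -> contfun R cptK) :
    (forall a : 'rV_j, `|lincomb h a| = `|a| /\ c / 4 * `|a| <= `|U (lincomb h a)|) ->
    expR (y / 256) <= j%:R ->
    exists (G : submodClosed (contfun R cptK)) (j : nat),
    [/\ expR ((272 * 272)^-1 * (16 * y)) <= j%:R,
        (banach_mazur (subsp G) (linfty R j) < 2%:E)%E &
        forall x, x \in G -> expR 32 `^ (- ((a / b) ^+ 2)) * `|x| <= `|U x|].
  move=> hP jle; apply: (finish j h 1 1) => [//||t|t|].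
  - by lra.
  - by have [-> _] := hP t; rewrite mul1r lexx.
  - by have [-> ] := hP t.
  - by apply: le_trans jle; rewrite ler_expR; lra.
have [j1 [h1 [j1P h1P]]] := linfty_of_signs Ule c01 S1 US (ltn_trans (ltnSn 0) n2).
have [j2 [h2 [j2P h2P]]] := linfty_of_orthonormal_basis Ule c01 S1 US.
have [] := max_family_size c0 (ler0n R j1) (ler0n R j2) ybig j1P j2P.
  exact: isometric h1P.
exact: isometric h2P.
Qed.
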